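(* Consider the linear model $y=X\beta^*+\varepsilon$ with random sub-Gaussian design, Gaussian noise $\varepsilon\sim N(0,\sigma_\varepsilon^2I_N)$ independent of $X$, and $\beta^*\in\mathcal{S}(k,s_1,s_2)$. Assume that $X$ is a row-wise $(\sigma_x,\Sigma_x)$-sub-Gaussian random matrix whose covariance $\Sigma_x$ has all eigenvalues in $[c,c']$ for constants $0<c\le c'$ not depending on the dimensions, and that $\Theta_x=\Sigma_x^{-1}$ satisfies $\max_{i}\sum_{j}|(\Theta_x)_{ij}|\le M_n$, where $M_n$ is allowed to grow with $n$. Let $\lambda\asymp\sigma_\varepsilon\sqrt{\frac{\log n}{N}}$, $\lambda_g=\lambda\sqrt{\nu/(2d)^{k+1}}$ where $0\le\nu<1$ and $d$ is the maximum degree of the underlying graph, and $\mu\asymp\sqrt{\frac{\log n}{N}}$. Assume $s_2/s_1\ge\nu$. Let $\tilde\beta$ be the one-step estimator built from the $k$-th order Graph-Piecewise-Polynomial-Lasso $\hat\beta$ (with tuning parameters $\lambda,\lambda_g$) and the CLIME matrix $\widehat\Theta$ (with tuning parameter $\mu$). Then $\sqrt N(\tilde\beta-\beta^* )=\Psi-e$, where $$\Psi\mid X\sim N\left(0,\sigma_\varepsilon^2\widehat\Theta\Sigma_N(\widehat\Theta)^T\right),\qquad\|e\|_\infty\le\mathcal{O}_{\mathbb{P}}\left(\frac{\sigma_\varepsilon s_2\log n}{\sqrt N}\right).$$ Furthermore, $$\left\|\widehat\Theta\Sigma_N(\widehat\Theta)^T-\Theta_x\right\|_\infty\le\mathcal{O}_{\mathbb{P}}\left(M_n\sqrt{\frac{\log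 n}{N}}\right).$$
   Context: Graph: $\mathcal{G}=(\mathcal{V},\mathcal{E})$ is a known undirected graph with $n$ nodes labelled $1,\dots,n$, $p$ edges, and maximum degree $d$. Its oriented incidence matrix $F\in\{-1,0,1\}^{p\times n}$ has, for the row corresponding to the edge $(i,j)$ with $i<j$, entry $-1$ in position $i$, $+1$ in position $j$, and $0$ elsewhere. The Laplacian is $L=F^TF$. Graph difference operators: $\Delta^{(1)}=F$, and for $k\ge1$, $\Delta^{(k+1)}=F^T\Delta^{(k)}=L^{(k+1)/2}$ if $k$ is odd, $\Delta^{(k+1)}=F\Delta^{(k)}=FL^{k/2}$ if $k$ is even. $k\ge0$ is a fixed integer. Parameter space: $\mathcal{S}(k,s_1,s_2)=\{\beta\in\mathbb{R}^n:\|\Delta^{(k+1)}\beta\|_0\le s_1,\ \|\beta\|_0\le s_2\}$, where $s_1,s_2>0$ and $\|\cdot\|_0$ counts nonzero entries. Design: a random variable $Z$ is $\sigma$-sub-Gaussian if $\mathbb{E}Z=0$ and $\mathbb{E}e^{tZ}\le e^{\sigma^2t^2/2}$ for all $t\in\mathbb{R}$; a random vector $Z$ is $\sigma$-sub-Gaussian if $\mathbb{E}Z=0$ and $u^TZ$ is $\sigma$-sub-Gaussian for every unit vector $u$. $X\in\mathbb{R}^{N\times n}$ is a row-wise $(\sigma_x,\Sigma_x)$-sub-Gaussian random matrix if its rows are i.i.d. from a $\sigma_x$-sub-Gaussian distribution with covariance matrix $\Sigma_x$. Estimators: for $\lambda>0,\lambda_g\ge0$, the $k$-th order Graph-Piecewise-Polynomial-Lasso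 is $$\hat\beta\in\arg\min_{\beta\in\mathbb{R}^n}\ \frac1{2N}\|y-X\beta\|_2^2+\lambda_g\|\Delta^{(k+1)}\beta\|_1+\lambda\|\beta\|_1 .$$ Let $\Sigma_N=\frac1NX^TX$. The CLIME matrix $\widehat\Theta\in\mathbb{R}^{n\times n}$ is a solution of: minimize $\|\Theta\|_{1,1}=\sum_{i,j}|\Theta_{ij}|$ over $\Theta\in\mathbb{R}^{n\times n}$ subject to $\|\Theta\Sigma_N-I_n\|_\infty\le\mu$. The one-step estimator is $\tilde\beta=\hat\beta+\frac1N\widehat\Theta X^T(y-X\hat\beta)$. $\|\cdot\|_\infty$ is the entrywise maximum absolute value for vectors and matrices. Asymptotics: $N,n,p,s_1,s_2$ are allowed to increase to $\infty$ (the graph changing accordingly); $k,\nu,\sigma_\varepsilon,\sigma_x$ and the eigenvalue bounds are fixed. $f\asymp g$ means equality of order up to positive constants; the choices $\lambda\asymp g$, $\mu\asymp h$ mean that $\lambda,\mu$ are taken to be $g,h$ times suitable positive constants. ''$Z\le\mathcal{O}_{\mathbb{P}}(a)$'' means that $Z/a$ is stochastically bounded.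
   Formalization: A sample-size condition N ≥ C0·s2·log n (for all large indices, C0 depending only on the fixed parameters) is added, since without it the bound on e fails (e.g. ν=0, Σ_x=I, n=s2=4N, β* a huge multiple of the all-ones vector). *)

(* Defs.v *)
From HB Require Import structures.
From mathcomp Require Import all_boot all_order all_algebra.
From mathcomp Require Import all_classical all_reals all_analysis.

Set Implicit Arguments.
Unset Strict Implicit.
Unset Printing Implicit Defensive.

Import Order.TTheory GRing.Theory Num.Theory.
Import numFieldNormedType.Exports.

Local Open Scope classical_set_scope.
Local Open Scope ring_scope.

Definition mx_display : measure_display.
Proof. exact: default_measure_display. Qed.

Section mx_borel.
Context {R : realType} {m n : nat}.

Definition mx_borel : set_system 'M[R]_(m, n) :=
  <<s \bigcup_(ij in [set: 'I_m * 'I_n])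
        preimage_set_system [set: 'M[R]_(m, n)]
          (fun A => A ij.1 ij.2) (@measurable _ R) >>.

Let mx_borel0 : mx_borel set0.
Proof. exact: sigma_algebra0. Qed.

Let mx_borelC A : mx_borel A -> mx_borel (~` A).
Proof. exact: sigma_algebraC. Qed.

Let mx_borel_bigcup (F : (set 'M[R]_(m, n))^nat) :
  (forall i, mx_borel (F i)) -> mx_borel (\bigcup_i (F i)).
Proof. exact: sigma_algebra_bigcup. Qed.

HB.instance Definition _ := @isMeasurable.Build mx_display
  'M[R]_(m, n) mx_borel mx_borel0 mx_borelC mx_borel_bigcup.

End mx_borel.

Record sgraph (n : nat) := SGraph {
  adj :> rel 'I_n;
  adj_sym : symmetric adj;
  adj_irr : irreflexive adj }.

Section graph.
Context {n : nat} (G : sgraph n).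

(* each undirected edge is listed once, as the pair (i, j) with i < j *)
Definition edges : {set 'I_n * 'I_n} :=
  [set ij : 'I_n * 'I_n | (ij.1 < ij.2)%N && G ij.1 ij.2]%SET.

Definition max_degree : nat := \max_(i : 'I_n) #|[set j | G i j]%SET|.

Context {R : realType}.

Definition incidence : 'M[R]_(#|edges|, n) :=
  \matrix_(l, v) if v == (enum_val l).1 then -1
                 else if v == (enum_val l).2 then 1 else 0.

(* [graph_diff j] is $\Delta^{(j)}$. It has [#|edges|] rows for odd [j] and [n]
   rows for even [j]. The recursion starts from the convention
   $\Delta^{(0)} = I$, which gives $\Delta^{(1)} = F$. *)
Definition graph_diff_step (b : bool) :
    'M[R]_(if b then #|edges| else n, n) ->
    'M[R]_(if ~~ b then #|edges| else n, n) :=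
  if b return 'M[R]_(if b then #|edges| else n, n) ->
              'M[R]_(if ~~ b then #|edges| else n, n)
  then fun D => incidence^T *m D
  else fun D => incidence *m D.

Fixpoint graph_diff (j : nat) : 'M[R]_(if odd j then #|edges| else n, n) :=
  match j with
  | 0 => 1%:M
  | j'.+1 => graph_diff_step (graph_diff j')
  end.

End graph.

(* The entrywise maximum norm of vectors and matrices is the library's
   [mx_norm]. *)

Section norms.
Context {R : realType}.

Definition norm0 {m} (v : 'cV[R]_m) : nat := #|[set i | v i 0 != 0]%SET|.

(* the vector l1-norm, and the (1,1)-norm of a matrix *)
Definition norm1 {m n} (A : 'M[R]_(m, n)) : R := \sum_i \sum_j `|A i j|.

Definition sqnorm2 {m} (v : 'cV[R]_m) : R := \sum_i v i 0 ^+ 2.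

End norms.

Section estimators.
Context {R : realType} {n N : nat}.

Definition param_space (G : sgraph n) (k s1 s2 : nat) : set 'cV[R]_n :=
  [set b | (norm0 (graph_diff G k.+1 *m b) <= s1)%N /\ (norm0 b <= s2)%N].

Definition lasso_obj (G : sgraph n) (k : nat) (lam lamg : R)
    (X : 'M[R]_(N, n)) (y : 'cV[R]_N) (b : 'cV[R]_n) : R :=
  sqnorm2 (y - X *m b) / (2 * N%:R)
  + lamg * norm1 (graph_diff G k.+1 *m b) + lam * norm1 b.

Definition is_gpp_lasso (G : sgraph n) (k : nat) (lam lamg : R)
    (X : 'M[R]_(N, n)) (y : 'cV[R]_N) (b : 'cV[R]_n) : Prop :=
  forall b', lasso_obj G k lam lamg X y b <= lasso_obj G k lam lamg X y b'.

Definition sample_cov (X : 'M[R]_(N, n)) : 'M[R]_n := N%:R^-1 *: (X^T *m X).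

Definition clime_feasible (S : 'M[R]_n) (mu : R) (Th : 'M[R]_n) : Prop :=
  mx_norm (Th *m S - 1%:M) <= mu.

Definition is_clime (S : 'M[R]_n) (mu : R) (Th : 'M[R]_n) : Prop :=
  clime_feasible S mu Th /\
  forall Th', clime_feasible S mu Th' -> norm1 Th <= norm1 Th'.

Definition one_step (X : 'M[R]_(N, n)) (y : 'cV[R]_N) (Th : 'M[R]_n)
    (b : 'cV[R]_n) : 'cV[R]_n :=
  b + N%:R^-1 *: (Th *m X^T *m (y - X *m b)).

End estimators.

Section probability.
Context {R : realType}.

Section single_space.
Context {d : measure_display} {T : measurableType d} (P : probability T R).

(* The bound at all [t] makes a measurable [Z] integrable, so ['E_P[Z] = 0] is
   a genuine mean. *)
Definition subgaussian (s : R) (Z : T -> R) : Prop :=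
  ('E_P[Z] = 0)%E /\
  forall t : R, ('M_P Z t <= (expR (s ^+ 2 * t ^+ 2 / 2))%:E)%E.

Definition subgaussian_vec (n : nat) (s : R) (Z : T -> 'rV[R]_n) : Prop :=
  (forall j, ('E_P[fun w => Z w ord0 j] = 0)%E) /\
  forall u : 'cV[R]_n, sqnorm2 u = 1 ->
    subgaussian s (fun w => (Z w *m u) 0 0).

(* Taking some [A i] to be the full space gives the product rule for every
   subfamily of rows. *)
Definition independent_rows (N n : nat) (X : T -> 'M[R]_(N, n)) : Prop :=
  forall A : 'I_N -> set 'rV[R]_n, (forall i, measurable (A i)) ->
    P [set w | forall i, A i (row i (X w))]
    = (\prod_(i < N) P [set w | A i (row i (X w))])%E.

Definition identically_distributed_rows (N n : nat)
    (X : T -> 'M[R]_(N, n)) : Prop :=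
  forall (i i' : 'I_N) (A : set 'rV[R]_n), measurable A ->
    P [set w | A (row i (X w))] = P [set w | A (row i' (X w))].

Definition rowwise_subgaussian (N n : nat) (s : R) (S : 'M[R]_n)
    (X : T -> 'M[R]_(N, n)) : Prop :=
  [/\ independent_rows X,
      identically_distributed_rows X,
      (forall i, subgaussian_vec s (fun w => row i (X w))) &
      (forall i j j', covariance P (fun w => X w i j) (fun w => X w i j')
                      = (S j j')%:E)].

Definition independent_rv d1 d2 (T1 : measurableType d1)
    (T2 : measurableType d2) (Y : T -> T1) (Z : T -> T2) : Prop :=
  forall A B, measurable A -> measurable B ->
    P (Y @^-1` A `&` Z @^-1` B) = (P (Y @^-1` A) * P (Z @^-1` B))%E.

(* $K$ is a regular conditional distribution of $Z$ given $Y$ *)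
Definition cond_distribution d1 d2 (T1 : measurableType d1)
    (T2 : measurableType d2) (Y : T -> T1) (Z : T -> T2)
    (K : R.-pker T1 ~> T2) : Prop :=
  forall A B, measurable A -> measurable B ->
    P (Y @^-1` A `&` Z @^-1` B) = (\int[P]_(w in Y @^-1` A) K (Y w) B)%E.

End single_space.

(* $N(0, v)$. The case $v = 0$ is treated apart because [normal_prob 0 0] is
   not the Dirac mass at 0. *)
Definition normal_law (v : R) (B : set R) : \bar R :=
  if v == 0 then \d_(0 : R) B else normal_prob 0 (Num.sqrt v) B.

(* $Q = N(0, V)$ on $\mathbb{R}^n$, $V$ possibly singular: every linear
   functional $u^T z$ has law $N(0, u^T V u)$. *)
Definition is_mvnormal (n : nat) (Q : set 'cV[R]_n -> \bar R) (V : 'M[R]_n) :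
    Prop :=
  forall (u : 'cV[R]_n) (B : set R), measurable B ->
    Q [set z | B ((u^T *m z) 0 0)] = normal_law ((u^T *m V *m u) 0 0) B.

Definition cond_mvnormal d (T : measurableType d) (P : probability T R)
    d1 (T1 : measurableType d1) (n : nat)
    (Y : T -> T1) (Z : T -> 'cV[R]_n) (V : T1 -> 'M[R]_n) : Prop :=
  exists K : R.-pker T1 ~> 'cV[R]_n,
    (forall x, is_mvnormal (K x) (V x)) /\ cond_distribution P Y Z K.

(* $Z_m \le O_{\mathbb{P}}(a_m)$ as $m \to \infty$; the [Z m] may live on
   different probability spaces. *)
Definition bigO_P (disp : nat -> measure_display)
    (T : forall m, measurableType (disp m)) (P : forall m, probability (T m) R)
    (Z : forall m, T m -> R) (a : nat -> R) : Prop :=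
  forall delta : R, 0 < delta ->
    exists2 C : R, 0 < C &
      \forall m \near \oo, (P m [set w | (C * a m < `|Z m w|)%R] <= delta%:E)%E.

End probability.

(* Main.v *)
Require Import Defs.
From HB Require Import structures.
From mathcomp Require Import all_boot all_order all_algebra.
From mathcomp Require Import all_classical all_reals all_analysis.
From mathcomp Require Import measurable_realfun.
From mathcomp Require Import ring lra.

(** The one-step estimator satisfies the exact identity
    [sqrt N (tilde beta - beta) = Psi - e] with
    [Psi = N^(-1/2) Th X' eps] and [e = sqrt N (Th S - I) (hat beta - beta)]
    ([one_step_decomposition]).  Given [X], the vector [Psi] is a fixed linear image
    of the Gaussian noise, which yields its conditional law
    ([linear_cond_mvnormal]).  The remainder [e] is at most [sqrt N] times the maximum
    norm of [Th S - I], that is [mu], times the l1 error of the lasso.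

    Everything else happens on a good event.  There the noise and the residual
    [T S - I] of the precision matrix [T] are entrywise of order [sqrt (ln n / N)], and
    the sample covariance form [S] is bounded below on sums of [q] signed basis
    vectors.  The last property involves only [(2 n)^q] vectors, so that a Chernoff
    bound for each of them and [N >= C0 s2 ln n] suffice.  Maurey's empirical method
    transfers it to all vectors, up to a multiple of the squared l1 norm divided by
    [q] ([restricted_eigenvalue]).  On the cone that contains the error of the lasso
    ([lasso_cone]) this is a restricted eigenvalue condition, and the l1 error is of
    order [s2 sqrt (ln n / N)] ([lasso_l1_error]).  The graph penalty enters through
    [graph_penalty_le]: the normalisation of its tuning parameter cancels the operator
    norm of the difference operator.

    The program defining the CLIME matrix splits over rows, so the rows of [Th] are no
    longer than those of any feasible matrix ([clime_row_l1]); since [T] is feasible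
    on the good event, this gives the covariance bound ([clime_covariance_error]).

    The tuning constants are fixed while the dimension need not grow, so
    that a given failure probability [delta] is reached in two ways.  If [n] is large
    compared to [1 / delta], the good event at the fixed noise level is likely enough
    ([large_dimension]).  If [n] stays bounded, the noise level must be raised beyond
    the penalties; then every l1 norm is comparable to the l2 norm, and the inverse of
    [S] replaces [T] as a feasible matrix ([inverse_feasible], [small_dimension]). *)

Set Implicit Arguments.
Unset Strict Implicit.
Unset Printing Implicit Defensive.

Import Order.TTheory GRing.Theory Num.Theory.
Import numFieldNormedType.Exports.

Local Open Scope classical_set_scope.
Local Open Scope ring_scope.

(** * Vectors, norms and quadratic forms *)

Section dot.
Context {R : realType}.

Definition dot {m} (u v : 'cV[R]_m) : R := \sum_i u i 0 * v i 0.

Lemma dotE m (u v : 'cV[R]_m) : dot u v = (u^T *m v) 0 0.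
Proof. by rewrite mxE; apply: eq_bigr => i _; rewrite mxE. Qed.

Lemma dotC m (u v : 'cV[R]_m) : dot u v = dot v u.
Proof. by apply: eq_bigr => i _; rewrite mulrC. Qed.

Lemma dotDl m (u v w : 'cV[R]_m) : dot (u + v) w = dot u w + dot v w.
Proof. by rewrite -big_split; apply: eq_bigr => i _; rewrite mxE mulrDl. Qed.

Lemma dotDr m (u v w : 'cV[R]_m) : dot w (u + v) = dot w u + dot w v.
Proof. by rewrite !(dotC w) dotDl. Qed.

Lemma dotZl m a (u v : 'cV[R]_m) : dot (a *: u) v = a * dot u v.
Proof. by rewrite mulr_sumr; apply: eq_bigr => i _; rewrite mxE mulrA. Qed.

Lemma dotZr m a (u v : 'cV[R]_m) : dot u (a *: v) = a * dot u v.
Proof. by rewrite dotC dotZl dotC. Qed.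

Lemma dotNl m (u v : 'cV[R]_m) : dot (- u) v = - dot u v.
Proof. by rewrite -scaleN1r dotZl mulN1r. Qed.

Lemma dotNr m (u v : 'cV[R]_m) : dot u (- v) = - dot u v.
Proof. by rewrite dotC dotNl dotC. Qed.

Lemma dotBl m (u v w : 'cV[R]_m) : dot (u - v) w = dot u w - dot v w.
Proof. by rewrite dotDl dotNl. Qed.

Lemma dotBr m (u v w : 'cV[R]_m) : dot w (u - v) = dot w u - dot w v.
Proof. by rewrite dotDr dotNr. Qed.

Lemma dot0l m (u : 'cV[R]_m) : dot 0 u = 0.
Proof. by rewrite -(scale0r 0) dotZl mul0r. Qed.

Lemma dot0r m (u : 'cV[R]_m) : dot u 0 = 0.
Proof. by rewrite dotC dot0l. Qed.

Lemma dot_suml m I (r : seq I) (z : I -> 'cV[R]_m) v :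
  dot (\sum_(j <- r) z j) v = \sum_(j <- r) dot (z j) v.
Proof.
by elim/big_rec2: _ => [|j x y _ <-]; rewrite ?dot0l ?dotDl.
Qed.

Lemma dot_sumr m I (r : seq I) (z : I -> 'cV[R]_m) v :
  dot v (\sum_(j <- r) z j) = \sum_(j <- r) dot v (z j).
Proof. by rewrite dotC dot_suml; apply: eq_bigr => j _; rewrite dotC. Qed.

Lemma dot_mulmx m p (A : 'M[R]_(m, p)) u v :
  dot u (A *m v) = dot (A^T *m u) v.
Proof. by rewrite !dotE trmx_mul trmxK mulmxA. Qed.

Lemma dot_delta m (i : 'I_m) (v : 'cV[R]_m) : dot (delta_mx i 0) v = v i 0.
Proof.
rewrite /dot (bigD1 i)//= mxE !eqxx mul1r big1 ?addr0// => j /negPf ji.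
by rewrite mxE ji mul0r.
Qed.

Lemma mulmx_delta m p (A : 'M[R]_(m, p)) i j : (A *m delta_mx j (0 : 'I_1)) i 0 = A i j.
Proof.
rewrite mxE (bigD1 j)//= mxE !eqxx mulr1 big1 ?addr0// => l /negPf lj.
by rewrite mxE lj mulr0.
Qed.

Lemma sqnorm2E m (v : 'cV[R]_m) : sqnorm2 v = dot v v.
Proof. by apply: eq_bigr => i _; rewrite expr2. Qed.

Lemma sqnorm2_ge0 m (v : 'cV[R]_m) : 0 <= sqnorm2 v.
Proof. by apply: sumr_ge0 => i _; exact: sqr_ge0. Qed.

Lemma sqnorm2_eq0 m (v : 'cV[R]_m) : sqnorm2 v = 0 -> v = 0.
Proof.
move=> /eqP; rewrite psumr_eq0 => [/allP h|i _]; last exact: sqr_ge0.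
apply/matrixP => i j; rewrite (ord1 j) mxE; apply/eqP.
by rewrite -sqrf_eq0; apply: h; rewrite mem_index_enum.
Qed.

Lemma sqnorm2Z m a (v : 'cV[R]_m) : sqnorm2 (a *: v) = a ^+ 2 * sqnorm2 v.
Proof. by rewrite !sqnorm2E dotZl dotZr mulrA expr2. Qed.

Lemma sqnorm2B m (u v : 'cV[R]_m) :
  sqnorm2 (u - v) = sqnorm2 u - 2 * dot u v + sqnorm2 v.
Proof. by rewrite !sqnorm2E dotBl !dotBr (dotC v u); ring. Qed.

Lemma sqnorm2_delta m (i : 'I_m) : sqnorm2 (delta_mx i 0 : 'cV[R]_m) = 1.
Proof. by rewrite sqnorm2E dot_delta mxE !eqxx. Qed.

Lemma le_sqnorm2_coord m (v : 'cV[R]_m) i : v i 0 ^+ 2 <= sqnorm2 v.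
Proof.
by rewrite /sqnorm2 (bigD1 i)//= lerDl sumr_ge0// => j _; exact: sqr_ge0.
Qed.

Lemma norm1_cV m (v : 'cV[R]_m) : norm1 v = \sum_i `|v i 0|.
Proof. by apply: eq_bigr => i _; rewrite big_ord1. Qed.

Lemma norm1_ge0 m p (v : 'M[R]_(m, p)) : 0 <= norm1 v.
Proof. by apply: sumr_ge0 => i _; apply: sumr_ge0. Qed.

Lemma ler_dot m (u v : 'cV[R]_m) eta :
  (forall i, `|u i 0| <= eta) -> `|dot u v| <= eta * norm1 v.
Proof.
move=> h; rewrite norm1_cV mulr_sumr (le_trans (ler_norm_sum _ _ _))//.
by apply: ler_sum => i _; rewrite normrM ler_wpM2r.
Qed.

(** The elementary form of Cauchy-Schwarz that compares a partial l1 norm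
    with the l2 norm through the number of summands. *)
Lemma l1_le_l2 m (J : {pred 'I_m}) (v : 'cV[R]_m) :
  (\sum_(i in J) `|v i 0|) ^+ 2 <= #|J|%:R * sqnorm2 v.
Proof.
set S := \sum_(i in J) _; have S0 : 0 <= S by exact: sumr_ge0.
have [J0|J0] := posnP #|J|.
  rewrite J0 mul0r /S big_pred0 ?expr0n// => i.
  by rewrite (card0_eq J0).
have c0 : 0 < #|J|%:R :> R by rewrite ltr0n.
have : 0 <= \sum_(i in J) (#|J|%:R * `|v i 0| - S) ^+ 2.
  by apply: sumr_ge0 => i _; exact: sqr_ge0.
have -> : \sum_(i in J) (#|J|%:R * `|v i 0| - S) ^+ 2 =
   #|J|%:R ^+ 2 * (\sum_(i in J) v i 0 ^+ 2) - #|J|%:R * S ^+ 2.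
  under eq_bigr => i _ do rewrite sqrrB exprMn real_normK ?num_real//.
  rewrite !big_split /= sumrN -mulr_sumr sumr_const -(mulr_natl (S ^+ 2)).
  have -> : \sum_(i in J) #|J|%:R * `|v i 0| * S *+ 2 =
            2 * (#|J|%:R * S ^+ 2).
    rewrite sumrMnl -mulr_suml -mulr_sumr -/S -mulr_natl; ring.
  by ring.
rewrite exprS expr1 -mulrA -mulrBr (pmulr_rge0 _ c0) subr_ge0 => h.
apply: (le_trans h); apply: ler_wpM2l; first exact: ltW.
rewrite /sqnorm2 [leRHS](bigID (mem J))//= lerDl.
by apply: sumr_ge0 => i _; exact: sqr_ge0.
Qed.

Lemma norm1_le_sqnorm2 m (v : 'cV[R]_m) : norm1 v ^+ 2 <= m%:R * sqnorm2 v.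
Proof.
have := l1_le_l2 predT v; rewrite card_ord norm1_cV.
by congr (_ ^+ 2 <= _); apply: eq_bigl.
Qed.

Lemma mx_norm_leP m p (A : 'M[R]_(m, p)) x :
  0 <= x -> (mx_norm A <= x) <-> (forall i j, `|A i j| <= x).
Proof.
move=> x0; rewrite mx_normrE; split=> [/bigmax_leP[_ h] i j|h].
  exact: (h (i, j)).
by apply/bigmax_leP; split.
Qed.

Lemma mx_norm_ge0 m p (A : 'M[R]_(m, p)) : 0 <= mx_norm A.
Proof. by rewrite /mx_norm. Qed.

Lemma mx_norm_entry m p (A : 'M[R]_(m, p)) i j : `|A i j| <= mx_norm A.
Proof. exact: (mx_norm_leP A (mx_norm_ge0 A)).1. Qed.

End dot.

Section spectrum.
Context {R : realType}.

Lemma eigenvalue_notin_unitmx n (A : 'M[R]_n) a :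
  A - a%:M \notin unitmx -> eigenvalue A a.
Proof.
apply: contraR; rewrite /eigenvalue negbK /eigenspace => /eqP K0.
by rewrite -row_free_unit -kermx_eq0 K0.
Qed.

Lemma quad_form_le n (A : 'M[R]_n) u :
  `|dot u (A *m u)| <= norm1 A * sqnorm2 u.
Proof.
rewrite /dot mulr_suml (le_trans (ler_norm_sum _ _ _))//; apply: ler_sum => i _.
rewrite mxE mulr_sumr mulr_suml (le_trans (ler_norm_sum _ _ _))//.
apply: ler_sum => j _; rewrite mulrCA normrM ler_wpM2l// normrM.
have h1 := le_sqnorm2_coord u i; have h2 := le_sqnorm2_coord u j.
rewrite -(real_normK (num_real (u i 0))) in h1.
rewrite -(real_normK (num_real (u j 0))) in h2.
have := sqr_ge0 (`|u i 0| - `|u j 0|); nra.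
Qed.

(** The form is nonnegative at [u - s A^-1 u], which bounds it at [u] from below by
    [2 s |u|^2] minus [s^2] times the form of the inverse; [s] is the inverse of a
    bound [K] for the latter. *)
Lemma psd_unit_coercive n (A : 'M[R]_n) : A^T = A -> A \in unitmx ->
  (forall u, 0 <= dot u (A *m u)) ->
  exists2 e, 0 < e & forall u, e * sqnorm2 u <= dot u (A *m u).
Proof.
move=> At Au A0; set K := norm1 (invmx A) + 1.
have K0 : 0 < K by rewrite ltr_wpDl ?norm1_ge0.
exists K^-1; first by rewrite invr_gt0.
move=> u; have := A0 (u - K^-1 *: (invmx A *m u)).
have AV : A *m (invmx A *m u) = u by rewrite mulmxA mulmxV// mul1mx.
rewrite mulmxBr -scalemxAr AV dotBl !dotBr !dotZl !dotZr.
rewrite (dot_mulmx A (invmx A *m u)) At AV -!sqnorm2E (dotC _ u).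
have : dot u (invmx A *m u) <= K * sqnorm2 u.
  rewrite (le_trans (ler_norm _))// (le_trans (quad_form_le _ _))//.
  by rewrite ler_wpM2r ?sqnorm2_ge0// lerDl.
move=> h; have : K^-1 * (K^-1 * dot u (invmx A *m u)) <= K^-1 * sqnorm2 u.
  by rewrite ler_pM2l ?invr_gt0// ler_pdivrMl.
by rewrite !mulrA; lra.
Qed.

(** The largest [l] with [l |u|^2 <= u'Au] for all [u] is an eigenvalue of the
    symmetric matrix [A], since otherwise [A - l I] would be coercive and [l]
    could be increased. *)
Lemma eigenvalue_rayleigh n (A : 'M[R]_n) c : A^T = A -> (0 < n)%N ->
  (forall a, eigenvalue A a -> c <= a) ->
  forall u, c * sqnorm2 u <= dot u (A *m u).
Proof.
move=> At n0 hc u.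
pose E := [set a | forall u, a * sqnorm2 u <= dot u (A *m u)].
have E0 : E (- norm1 A).
  move=> v; have := quad_form_le A v; rewrite ler_norml => /andP[+ _].
  by rewrite mulNr.
have Eub : ubound E (dot (delta_mx (Ordinal n0) 0) (A *m delta_mx (Ordinal n0) 0)).
  by move=> a /(_ (delta_mx (Ordinal n0) 0)); rewrite sqnorm2_delta mulr1.
have supE : has_sup E by split; [exists (- norm1 A)|eexists; exact: Eub].
have EA : E (sup E).
  move=> v; have [v0|v0] := eqVneq (sqnorm2 v) 0.
    by rewrite v0 mulr0 (sqnorm2_eq0 v0) dot0l.
  have vp : 0 < sqnorm2 v by rewrite lt_def v0 sqnorm2_ge0.
  rewrite -ler_pdivlMr//; apply: ge_sup; first by case: supE.
  by move=> a aE; rewrite ler_pdivlMr//; exact: aE.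
suff lc : c <= sup E.
  by rewrite (le_trans _ (EA u))// ler_wpM2r ?sqnorm2_ge0.
apply/hc/eigenvalue_notin_unitmx; apply/negP => Bu.
have qB v : dot v ((A - (sup E)%:M) *m v) = dot v (A *m v) - sup E * sqnorm2 v.
  by rewrite mulmxBl dotBr mul_scalar_mx dotZr sqnorm2E.
have [||e e0 he] := psd_unit_coercive _ Bu.
- by rewrite linearB/= At tr_scalar_mx.
- by move=> v; rewrite qB subr_ge0; exact: EA.
have : E (sup E + e).
  by move=> v; rewrite mulrDl -lerBrDl -qB; exact: he.
move=> /(ub_le_sup (proj2 supE)); lra.
Qed.

End spectrum.

(** * Graph difference operators *)

Section graph_operator.
Context {R : realType} {n : nat} (G : sgraph n).

Lemma incidence_entry (v : 'cV[R]_n) l :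
  (incidence G *m v) l 0 = v (enum_val l).2 0 - v (enum_val l).1 0.
Proof.
have /setIdP[/=lt12 _] := enum_valP l.
have ne : (enum_val l).2 != (enum_val l).1.
  by apply/eqP => e; rewrite e ltnn in lt12.
rewrite mxE (bigD1 (enum_val l).2)//= (bigD1 (enum_val l).1) ?(eq_sym _ (enum_val l).2)//=.
rewrite !mxE !eqxx (negPf ne) big1; first by ring.
by move=> i /andP[/negPf i2 /negPf i1]; rewrite mxE i1 i2 mul0r.
Qed.

(** Each edge costs [(x - y)^2 <= 2 x^2 + 2 y^2], and a vertex belongs to at most
    [max_degree G] edges. *)
Lemma incidence_bound (v : 'cV[R]_n) :
  sqnorm2 (incidence G *m v) <= 2 * (max_degree G)%:R * sqnorm2 v.
Proof.
have -> : sqnorm2 (incidence G *m v) =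
    \sum_(e in edges G) (v e.2 0 - v e.1 0) ^+ 2.
  rewrite big_enum_val; apply: eq_bigr => l _.
  by rewrite incidence_entry.
apply: (@le_trans _ _ (\sum_(e in edges G) (2 * v e.1 0 ^+ 2 + 2 * v e.2 0 ^+ 2))).
  apply: ler_sum => e _; have := sqr_ge0 (v e.2 0 + v e.1 0); lra.
rewrite big_split/= -!mulr_sumr -mulrDr -mulrA ler_wpM2l//.
apply: (@le_trans _ _ (\sum_i \sum_(j | G i j) v i 0 ^+ 2)); last first.
  rewrite /sqnorm2 mulr_sumr; apply: ler_sum => i _.
  rewrite sumr_const -[leLHS]mulr_natl ler_wpM2r ?sqr_ge0// ler_nat.
  apply: (@leq_trans #|[set j | G i j]%SET|); first by rewrite cardsE.
  exact: (@leq_bigmax_cond _ xpredT (fun i : 'I_n => #|[set j | G i j]%SET|)).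
have h1 : \sum_(e in edges G) v e.1 0 ^+ 2 =
    \sum_(i : 'I_n) \sum_(j : 'I_n | (i < j)%N && G i j) v i 0 ^+ 2.
  rewrite (pair_big_dep xpredT) /=; apply: eq_bigl => e.
  by rewrite inE.
have h2 : \sum_(e in edges G) v e.2 0 ^+ 2 =
    \sum_(i : 'I_n) \sum_(j : 'I_n | (j < i)%N && G i j) v i 0 ^+ 2.
  rewrite (exchange_big_dep xpredT)//= (pair_big_dep xpredT) /=.
  by apply: eq_bigl => e; rewrite inE (adj_sym G e.2).
rewrite h1 h2 -big_split/=; apply: ler_sum => i _.
rewrite [leRHS](bigID (fun j : 'I_n => (i < j)%N))/=; apply: lerD.
  by under eq_bigl do rewrite andbC.
rewrite le_eqVlt; apply/orP; left; apply/eqP/eq_bigl => j.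
rewrite -leqNgt andbC; case: (boolP (G i j)) => //= Gij.
rewrite ltn_neqAle; case: eqVneq => //= ij.
by move: Gij; rewrite (ord_inj ij) (adj_irr G).
Qed.

(** With [z = F'u] one has [|z|^2 = u'Fz], and the claim follows by expanding
    [|B u - F z|^2 >= 0]. *)
Lemma trmx_bound p (F : 'M[R]_(p, n)) (B : R) : 0 <= B ->
  (forall v, sqnorm2 (F *m v) <= B * sqnorm2 v) ->
  forall u, sqnorm2 (F^T *m u) <= B * sqnorm2 u.
Proof.
move=> B0 hF u; set z := F^T *m u.
have zz : sqnorm2 z = dot u (F *m z) by rewrite dot_mulmx sqnorm2E.
have := hF z; have := sqnorm2_ge0 (B *: u - F *m z).
rewrite sqnorm2B sqnorm2Z dotZl -zz => h1 h2.
have [B_0|Bn0] := eqVneq B 0.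
  rewrite B_0 mul0r in h2; rewrite B_0 mul0r.
  have /sqnorm2_eq0 w0 : sqnorm2 (F *m z) = 0.
    by apply/eqP; rewrite eq_le h2 sqnorm2_ge0.
  by rewrite zz w0 dot0r.
have Bp : 0 < B by rewrite lt_def Bn0.
by rewrite -(ler_pM2l Bp) mulrA -expr2; lra.
Qed.

(** Passing from one order to the next multiplies by the incidence matrix or by
    its transpose, and both have squared operator norm at most twice the degree. *)
Lemma graph_diff_bound j (v : 'cV[R]_n) :
  sqnorm2 (graph_diff G j *m v) <= (2 * (max_degree G)%:R) ^+ j * sqnorm2 v.
Proof.
have d0 : 0 <= 2 * (max_degree G)%:R :> R by rewrite mulr_ge0.
have step c (D : 'M[R]_(if c then #|edges G| else n, n)) :
    sqnorm2 (graph_diff_step D *m v) <=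
    2 * (max_degree G)%:R * sqnorm2 (D *m v).
  case: c D => D /=; rewrite -mulmxA; last exact: incidence_bound.
  by apply: trmx_bound => // u; exact: incidence_bound.
elim: j => [|j IH]; first by rewrite expr0 mul1r mul1mx.
rewrite exprS -mulrA; apply: le_trans (step _ (graph_diff G j)) _.
exact: ler_wpM2l.
Qed.

End graph_operator.

(** * Error bounds for the graph lasso *)

Section lasso.
Context {R : realType}.

(** Moving from [b] to [b + v], the l1 norm drops by at most the mass of [v]
    on the support of [b], and it gains the mass of [v] off this support. *)
Lemma norm1_support m (v b : 'cV[R]_m) :
  norm1 b - norm1 (b + v) <=
  2 * \sum_(i in [set i | b i 0 != 0]%SET) `|v i 0| - norm1 v.
Proof.
set J := [set i | b i 0 != 0]%SET.
rewrite !norm1_cV [\sum_i `|v i 0|](bigID (mem J))/= -sumrB (bigID (mem J))/=.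
set A := \sum_(i in J) `|v i 0|; set B := \sum_(i | i \notin J) `|v i 0|.
have -> : 2 * A - (A + B) = A - B by ring.
apply: lerD.
  apply: ler_sum => i _; rewrite mxE.
  have := ler_normB (b i 0 + v i 0) (v i 0); rewrite addrK; lra.
rewrite -sumrN; apply: ler_sum => i; rewrite inE negbK => /eqP b0.
by rewrite mxE b0 normr0 sub0r add0r.
Qed.

Lemma support_l1_le_l2 m (v b : 'cV[R]_m) s : (norm0 b <= s)%N ->
  \sum_(i in [set i | b i 0 != 0]%SET) `|v i 0| <=
  Num.sqrt s%:R * Num.sqrt (sqnorm2 v).
Proof.
move=> bs; rewrite -sqrtrM ?ler0n//.
rewrite -[leLHS]ger0_norm ?sumr_ge0// -sqrtr_sqr ler_wsqrtr//.
by rewrite (le_trans (l1_le_l2 _ _))// ler_wpM2r ?sqnorm2_ge0// ler_nat.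
Qed.

Lemma norm1_sparse m (v b : 'cV[R]_m) s : (norm0 b <= s)%N ->
  norm1 b - norm1 (b + v) <= Num.sqrt s%:R * Num.sqrt (sqnorm2 v).
Proof.
move=> bs; rewrite (le_trans (norm1_support v b))//.
rewrite (le_trans _ (support_l1_le_l2 v bs))//.
set J := [set i | b i 0 != 0]%SET.
rewrite norm1_cV [\sum_i `|v i 0|](bigID (mem J))/=.
have : 0 <= \sum_(i | i \notin J) `|v i 0| by exact: sumr_ge0.
lra.
Qed.

Section error.
Context {n N : nat} (G : sgraph n) (k s1 s2 : nat) (lam nu : R).
Context (X : 'M[R]_(N, n)) (b bh : 'cV[R]_n) (e : 'cV[R]_N) (eta : R).
Let lamg := lam * Num.sqrt (nu / (2 * (max_degree G)%:R) ^+ k.+1).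
Hypotheses (N0 : (0 < N)%N) (lam0 : 0 < lam) (s10 : (0 < s1)%N) (nu0 : 0 <= nu).
Hypothesis hs : nu <= s2%:R / s1%:R.
Hypothesis hb : param_space G k s1 s2 b.
Hypothesis hopt : is_gpp_lasso G k lam lamg X (X *m b + e) bh.
Hypothesis heta : forall i, `|(N%:R^-1 *: (X^T *m e)) i 0| <= eta.
Let D := bh - b.
Let r2 := Num.sqrt s2%:R * Num.sqrt (sqnorm2 D).

(** The operator norm [(2 d)^((k+1)/2)] of the difference operator is cancelled by
    the normalisation of [lamg], and [nu * s1 <= s2] replaces one sparsity level by
    the other. *)
Lemma graph_penalty_le :
  lamg * (norm1 (graph_diff G k.+1 *m b) - norm1 (graph_diff G k.+1 *m bh))
  <= lam * r2.
Proof.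
rewrite /lamg -mulrA ler_wpM2l ?(ltW lam0)//.
have -> : bh = b + D by rewrite /D addrC subrK.
rewrite mulmxDr; set F := graph_diff G k.+1; set g := (_ * _ : R) ^+ _.
have g0 : 0 <= g by rewrite exprn_ge0 ?mulr_ge0.
apply: (@le_trans _ _ (Num.sqrt (nu / g) *
    (Num.sqrt s1%:R * Num.sqrt (g * sqnorm2 D)))).
  rewrite ler_wpM2l ?sqrtr_ge0// (le_trans (norm1_sparse _ hb.1))//.
  by rewrite ler_wpM2l ?sqrtr_ge0// ler_wsqrtr// graph_diff_bound.
rewrite (sqrtrM (sqnorm2 D) g0) !mulrA ler_wpM2r ?sqrtr_ge0//.
rewrite -!sqrtrM ?mulr_ge0 ?divr_ge0 ?invr_ge0//; apply: ler_wsqrtr.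
have [->|gn0] := eqVneq g 0; first by rewrite mulr0 ler0n.
rewrite mulrAC divfK// mulrC; move: hs; rewrite ler_pdivlMr ?ltr0n//.
by rewrite mulrC.
Qed.

(** Optimality of [bh] against [b], with the noise bounded by duality of the l1
    and the maximum norm. *)
Lemma lasso_basic_inequality :
  dot D (sample_cov X *m D) / 2 <=
  eta * norm1 D + lam * r2
  + lam * (2 * (\sum_(i in [set i | b i 0 != 0]%SET) `|D i 0|) - norm1 D).
Proof.
have NR0 : 0 < N%:R :> R by rewrite ltr0n.
have := hopt b; rewrite /lasso_obj (addrC (X *m b) e) addrK (addrC e).
have -> : X *m b + e - X *m bh = e - X *m D.
  by rewrite /D mulmxBr; apply/matrixP => i j; rewrite !mxE; ring.
rewrite (sqnorm2B e).
have -> : sqnorm2 (X *m D) = N%:R * dot D (sample_cov X *m D).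
  rewrite /sample_cov -scalemxAl dotZr mulrA divff ?gt_eqF// mul1r -mulmxA.
  by rewrite sqnorm2E (dot_mulmx _ D) trmxK.
have -> : dot e (X *m D) = N%:R * dot (N%:R^-1 *: (X^T *m e)) D.
  by rewrite dotZl mulrA divff ?gt_eqF// mul1r dot_mulmx.
have := le_trans (ler_norm _) (ler_dot D heta).
move: (dot _ D) (dot D _) => gD Q hg.
have := graph_penalty_le.
have : lam * (norm1 b - norm1 bh) <=
  lam * (2 * (\sum_(i in [set i | b i 0 != 0]%SET) `|D i 0|) - norm1 D).
  rewrite ler_wpM2l ?(ltW lam0)//; have := norm1_support D b.
  by rewrite {1}/D (addrC b) subrK.
rewrite !mulrBr => h1 h2 h3.
have -> : Q / 2 = (sqnorm2 e - 2 * (N%:R * gD) + N%:R * Q) / (2 * N%:R)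
   - sqnorm2 e / (2 * N%:R) + gD by field; rewrite gt_eqF.
lra.
Qed.

(** When the penalty dominates the noise, the error lies in the cone where the
    l1 norm is controlled by the l2 norm at the sparsity level. *)
Lemma lasso_cone : 2 * eta <= lam ->
  norm1 D ^+ 2 <= 36 * s2%:R * sqnorm2 D.
Proof.
move=> eta_lam.
have Q0 : 0 <= dot D (sample_cov X *m D).
  rewrite /sample_cov -scalemxAl dotZr mulr_ge0 ?invr_ge0// -mulmxA.
  by rewrite (dot_mulmx _ D) trmxK -sqnorm2E sqnorm2_ge0.
have := lasso_basic_inequality; have := support_l1_le_l2 D hb.2.
rewrite -/r2; set S := \sum_(i in _) _ => hS hbasic.
have n0 := norm1_ge0 D.
have r0 : 0 <= r2 by rewrite mulr_ge0 ?sqrtr_ge0.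
have : lam * norm1 D <= lam * (6 * r2).
  have : lam * S <= lam * r2 by rewrite ler_pM2l.
  have : eta * norm1 D * 2 <= lam * norm1 D.
    by rewrite mulrAC (mulrC eta) ler_wpM2r.
  rewrite mulrBr in hbasic; lra.
rewrite ler_pM2l// => h.
have -> : 36 * s2%:R * sqnorm2 D = (6 * r2) ^+ 2.
  by rewrite /r2 !exprMn !sqr_sqrtr ?sqnorm2_ge0 ?ler0n//; ring.
by rewrite ler_sqr// nnegrE mulr_ge0.
Qed.

(** The basic inequality is quadratic in the error on the left and linear on the
    right, so a coercive design bounds the l2 norm of the error, and then its l1
    norm through [L]. *)
Lemma lasso_l1_error (L H kappa : R) : 0 < kappa -> 0 <= eta -> 1 <= H ->
  norm1 D ^+ 2 <= L * sqnorm2 D -> L <= H * s2%:R ->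
  kappa * sqnorm2 D <= dot D (sample_cov X *m D) ->
  norm1 D <= 2 / kappa * (eta + 2 * lam) * (H * s2%:R).
Proof.
move=> k0 e0 H1 hL LH hk; have H0 : 0 <= H by lra.
have el0 : 0 <= eta + 2 * lam by have := lam0; lra.
have n0 := norm1_ge0 D; have D0 := sqnorm2_ge0 D.
set q := Num.sqrt (sqnorm2 D); have q0 : 0 <= q := sqrtr_ge0 _.
have qq : sqnorm2 D = q ^+ 2 by rewrite sqr_sqrtr.
set t := Num.sqrt (H * s2%:R); have t0 : 0 <= t := sqrtr_ge0 _.
have tt : H * s2%:R = t ^+ 2 by rewrite sqr_sqrtr// mulr_ge0.
have nD : norm1 D <= t * q.
  rewrite -ler_sqr ?nnegrE ?mulr_ge0// exprMn -tt -qq.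
  by rewrite (le_trans hL)// ler_wpM2r.
have r2t : r2 <= t * q.
  rewrite ler_wpM2r// /t ler_wsqrtr// ler_peMl//.
have hJ : \sum_(i in [set i | b i 0 != 0]%SET) `|D i 0| <= norm1 D.
  rewrite norm1_cV [leRHS](bigID (mem [set i | b i 0 != 0]%SET))/= lerDl.
  exact: sumr_ge0.
have := lasso_basic_inequality; rewrite qq in hk.
move: hJ; set S := \sum_(i in _) _ => hJ hbasic.
have h1 : kappa / 2 * q ^+ 2 <= (eta + 2 * lam) * t * q.
  have : lam * (2 * S - norm1 D) <= lam * (t * q).
    by rewrite ler_pM2l//; lra.
  have : lam * r2 <= lam * (t * q) by rewrite ler_pM2l.
  have : eta * norm1 D <= eta * (t * q) by rewrite ler_wpM2l.
  lra.
have h2 : q <= 2 / kappa * (eta + 2 * lam) * t.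
  have [->|qn0] := eqVneq q 0; first by rewrite !mulr_ge0 ?invr_ge0 ?(ltW k0).
  have qp : 0 < q by rewrite lt_def qn0.
  move: h1; rewrite expr2 mulrA ler_pM2r// => h1.
  rewrite -(ler_pM2l (divr_gt0 k0 (ltr0n _ 2))) (le_trans h1)//.
  by rewrite le_eqVlt; apply/orP; left; apply/eqP; field; rewrite gt_eqF.
rewrite tt expr2 mulrA; apply: (le_trans nD); rewrite mulrC.
exact: ler_wpM2r.
Qed.

End error.
End lasso.

(** * Restricted eigenvalues by the empirical method of Maurey *)

Section maurey.
Context {R : realType} {n : nat}.
Implicit Types (A : 'M[R]_n) (v : 'cV[R]_n).

(** Maurey's empirical method without a product measure: drawing [q] vectors
    from the weights [w] and adding them to [v] gives, in the mean, the value
    of the quadratic form on the right.  One draw at a time, the induction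
    averages over the next vector [z j]. *)
Lemma maurey_average (J : finType) A (w : J -> R) (z : J -> 'cV[R]_n) q :
  A^T = A -> (forall j, 0 <= w j) -> \sum_j w j = 1 ->
  forall v,
  (forall t : seq J, size t = q ->
     0 <= dot (v + \sum_(j <- t) z j) (A *m (v + \sum_(j <- t) z j))) ->
  let zb := \sum_j w j *: z j in
  0 <= dot v (A *m v) + 2 * q%:R * dot v (A *m zb)
     + q%:R * (\sum_j w j * dot (z j) (A *m z j))
     + q%:R * (q%:R - 1) * dot zb (A *m zb).
Proof.
move=> At w0 w1; elim: q => [|q IH] v h /=; last set zb := \sum_j w j *: z j.
  have := h [::] erefl; rewrite big_nil addr0 /=.
  by rewrite mulr0 !mul0r !addr0.
set E := \sum_j _ * dot (z j) _; set Q := dot zb _.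
have key j : 0 <= dot (v + z j) (A *m (v + z j))
    + 2 * q%:R * dot (v + z j) (A *m zb) + q%:R * E + q%:R * (q%:R - 1) * Q.
  apply: IH => t st; have := h (j :: t); rewrite /= st => /(_ erefl).
  by rewrite big_cons addrA.
have zE : \sum_j w j * dot (z j) (A *m zb) = Q.
  by rewrite /Q {1}/zb dot_suml; apply: eq_bigr => j _; rewrite dotZl.
have vE : \sum_j w j * dot v (A *m z j) = dot v (A *m zb).
  by rewrite /zb mulmx_sumr dot_sumr; apply: eq_bigr => j _; rewrite -scalemxAr dotZr.
have : 0 <= \sum_j w j * (dot (v + z j) (A *m (v + z j))
    + 2 * q%:R * dot (v + z j) (A *m zb) + q%:R * E + q%:R * (q%:R - 1) * Q).
  by apply: sumr_ge0 => j _; rewrite mulr_ge0.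
have -> : \sum_j w j * (dot (v + z j) (A *m (v + z j))
    + 2 * q%:R * dot (v + z j) (A *m zb) + q%:R * E + q%:R * (q%:R - 1) * Q)
  = \sum_j (w j * (dot v (A *m v) + 2 * q%:R * dot v (A *m zb) + q%:R * E
        + q%:R * (q%:R - 1) * Q)
     + 2 * (w j * dot v (A *m z j)) + w j * dot (z j) (A *m z j)
     + 2 * q%:R * (w j * dot (z j) (A *m zb))).
  apply: eq_bigr => j _; rewrite mulmxDr !dotDl !dotDr.
  have -> : dot (z j) (A *m v) = dot v (A *m z j) by rewrite dotC (dot_mulmx A v) At.
  by ring.
rewrite !big_split/= -mulr_suml w1 mul1r -!mulr_sumr vE zE -/E -natr1.
by move=> h1; rewrite (le_trans h1)// le_eqVlt; apply/orP; left; apply/eqP; ring.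
Qed.

Definition signed_sum (t : seq ('I_n * bool)) : 'cV[R]_n :=
  \sum_(p <- t) (-1) ^+ p.2 *: delta_mx p.1 0.

(** Transfer principle: a lower bound for the quadratic form on sums of [q]
    signed basis vectors, a finite set, extends to all vectors up to a
    multiple of the squared l1 norm. *)
Lemma restricted_eigenvalue (S : 'M[R]_n) (kappa D : R) (q : nat) : S^T = S ->
  0 <= kappa -> (0 < q)%N ->
  (forall j, S j j <= D) ->
  (forall t : q.-tuple ('I_n * bool),
     kappa * sqnorm2 (signed_sum t) <= dot (signed_sum t) (S *m signed_sum t)) ->
  forall v, (q%:R - 1) * (kappa * sqnorm2 v - dot v (S *m v)) <= D * norm1 v ^+ 2.
Proof.
move=> St k0 q0 hD hS v; set l := norm1 v.
have [l0|ln0] := eqVneq l 0.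
  have -> : v = 0.
    apply/matrixP => i j; rewrite (ord1 j) mxE; apply/eqP.
    rewrite -normr_eq0; apply/eqP.
    have := l0; rewrite /l norm1_cV => /eqP.
    by rewrite psumr_eq0// => /allP /(_ i); rewrite mem_index_enum => /(_ isT)/eqP.
  by rewrite sqnorm2E !dot0l mulr0 subrr mulr0 l0 expr0n mulr0.
have lp : 0 < l by rewrite lt_def ln0 norm1_ge0.
pose A := S - kappa%:M.
have At : A^T = A by rewrite linearB/= St tr_scalar_mx.
have qA u : dot u (A *m u) = dot u (S *m u) - kappa * sqnorm2 u.
  by rewrite mulmxBl dotBr mul_scalar_mx dotZr sqnorm2E.
pose w j := `|v j 0| / l.
pose p j := (j, v j 0 < 0).
pose z j : 'cV[R]_n := l *: ((-1) ^+ (v j 0 < 0)%R *: delta_mx j 0).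
have w0 j : 0 <= w j by rewrite divr_ge0 ?norm1_ge0.
have w1 : \sum_j w j = 1 by rewrite -mulr_suml -norm1_cV divff.
have zb : \sum_j w j *: z j = v.
  rewrite [RHS]matrix_sum_delta; apply: eq_bigr => j _.
  rewrite big_ord1 /z !scalerA /w divfK//; congr (_ *: _).
  case: ltrP => h /=; first by rewrite expr1 mulrN1 ltr0_norm// opprK.
  by rewrite expr0 mulr1 ger0_norm.
have := @maurey_average _ A w z q At w0 w1 0; rewrite /= zb !dot0l mulr0 !add0r.
have hq t : size t = q -> 0 <= dot (0 + \sum_(j <- t) z j) (A *m (0 + \sum_(j <- t) z j)).
  move=> st; rewrite add0r.
  have sp : size (map p t) == q by rewrite size_map st.
  have -> : \sum_(j <- t) z j = l *: signed_sum (Tuple sp).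
    by rewrite /signed_sum /= big_map scaler_sumr.
  rewrite -scalemxAr dotZl dotZr mulrA mulr_ge0 ?mulr_ge0 ?norm1_ge0//.
  by rewrite qA subr_ge0.
move=> /(_ hq).
have zz j : dot (z j) (A *m z j) <= l ^+ 2 * D.
  rewrite /z -!scalemxAr !dotZl !dotZr !mulrA.
  have -> : l * (-1) ^+ (v j 0 < 0)%R * l * (-1) ^+ (v j 0 < 0)%R = l ^+ 2.
    have := sqrr_sign R (v j 0 < 0)%R; rewrite expr2 => e.
    by rewrite -!mulrA (mulrCA _ l) e mulr1 expr2.
  rewrite ler_wpM2l ?sqr_ge0// qA sqnorm2_delta mulr1 dot_delta mulmx_delta.
  by rewrite (le_trans _ (hD j))// gerBl.
have : \sum_j w j * dot (z j) (A *m z j) <= l ^+ 2 * D.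
  rewrite -[leRHS]mul1r -w1 mulr_suml; apply: ler_sum => j _.
  by rewrite ler_wpM2l.
rewrite qA => h1 h2.
have qp : 0 < q%:R :> R by rewrite ltr0n.
rewrite -(ler_pM2l qp); have := ler_wpM2l (ltW qp) h1.
by move: h2; rewrite mulrBr; move: (dot v _) (sqnorm2 v) => a b; nra.
Qed.

End maurey.

(** * The CLIME matrix *)

Section clime.
Context {R : realType} {n : nat}.
Implicit Types S Th : 'M[R]_n.

Definition row_l1_le Th (K : R) := forall i, \sum_j `|Th i j| <= K.

Lemma row_mulmx_le Th S (K x : R) : 0 <= x -> row_l1_le Th K ->
  (forall i j, `|S i j| <= x) -> forall i j, `|(Th *m S) i j| <= K * x.
Proof.
move=> x0 hT hS i j; rewrite mxE (le_trans (ler_norm_sum _ _ _))//.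
apply: (@le_trans _ _ (\sum_l `|Th i l| * x)).
  by apply: ler_sum => l _; rewrite normrM ler_wpM2l.
by rewrite -mulr_suml ler_wpM2r.
Qed.

Lemma trmx_mulmx_le Th S (K x : R) : 0 <= x -> row_l1_le Th K ->
  (forall i j, `|S i j| <= x) -> forall i j, `|(S *m Th^T) i j| <= K * x.
Proof.
move=> x0 hT hS i j.
have -> : (S *m Th^T) i j = (Th *m S^T) j i.
  by rewrite -[in RHS](trmxK Th) -trmx_mul [RHS]mxE.
by apply: row_mulmx_le => // a b; rewrite mxE.
Qed.

(** The program defining the CLIME matrix splits into one program per row, so
    each row of a solution has minimal l1 norm among the feasible rows. *)
Lemma clime_row_l1 S mu Th T0 : is_clime S mu Th -> clime_feasible S mu T0 ->
  forall i, \sum_j `|Th i j| <= \sum_j `|T0 i j|.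
Proof.
move=> [fTh hmin] fT0 i.
have mu0 : 0 <= mu := le_trans (mx_norm_ge0 _) fTh.
pose T1 : 'M[R]_n := \matrix_(a, b) if a == i then T0 a b else Th a b.
have : clime_feasible S mu T1.
  move: fTh fT0; rewrite /clime_feasible => /(mx_norm_leP _ mu0) h1.
  move=> /(mx_norm_leP _ mu0) h2; apply/(mx_norm_leP _ mu0) => a b.
  have [ai|ai] := eqVneq a i.
    have -> : (T1 *m S - 1%:M) a b = (T0 *m S - 1%:M) a b => //.
    by rewrite !mxE; congr (_ - _); apply: eq_bigr => c _; rewrite !mxE ai eqxx.
  have -> : (T1 *m S - 1%:M) a b = (Th *m S - 1%:M) a b => //.
  rewrite !mxE; congr (_ - _); apply: eq_bigr => c _.
  by rewrite !mxE (negPf ai).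
move=> /hmin; rewrite /norm1 (bigD1 i)//= [leRHS](bigD1 i)//=.
have -> : \sum_j `|T1 i j| = \sum_j `|T0 i j|.
  by apply: eq_bigr => j _; rewrite mxE eqxx.
have -> : \sum_(a | a != i) \sum_j `|T1 a j| = \sum_(a | a != i) \sum_j `|Th a j|.
  by apply: eq_bigr => a ai; apply: eq_bigr => j _; rewrite mxE (negPf ai).
by rewrite lerD2r.
Qed.

(** Write [Th S Th' - T] as [(Th S - I) Th'] plus the transpose of
    [Th (I - S T) + (Th S - I) T]. *)
Lemma clime_covariance_error S Th (T0 : 'M[R]_n) (K M mu x : R) : S^T = S -> T0^T = T0 ->
  0 <= mu -> 0 <= x ->
  row_l1_le Th K -> row_l1_le T0 M -> clime_feasible S mu Th ->
  (forall i j, `|(T0 *m S - 1%:M) i j| <= x) ->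
  forall i j, `|(Th *m S *m Th^T - T0) i j| <= K * mu + K * x + M * mu.
Proof.
move=> St Tt mu0 x0 hTh hT0 /(mx_norm_leP _ mu0) h1 h2 i j.
have -> : Th *m S *m Th^T - T0 = (Th *m S - 1%:M) *m Th^T
   + (Th *m (1%:M - S *m T0) + (Th *m S - 1%:M) *m T0^T)^T.
  rewrite Tt !(mulmxBl, mulmxBr, mul1mx, mulmx1) mulmxA.
  by rewrite !linearD !linearN/= Tt; apply/matrixP => a b; rewrite !mxE; ring.
have h3 a b : `|(1%:M - S *m T0) a b| <= x.
  have -> : 1%:M - S *m T0 = - (T0 *m S - 1%:M)^T.
    by rewrite linearB/= trmx1 trmx_mul St Tt opprB.
  by rewrite mxE mxE normrN.
rewrite mxE (le_trans (ler_normD _ _))// -addrA; apply: lerD.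
  exact: trmx_mulmx_le.
rewrite mxE mxE (le_trans (ler_normD _ _))//; apply: lerD.
  exact: row_mulmx_le.
exact: trmx_mulmx_le.
Qed.

(** If [T0 S = I + E] with [E] small, then [S v = 0] forces [v = - E v], hence
    [v = 0]; the inverse [V] solves [V = T0 - E V], which at most doubles the length
    of the rows.  An exact inverse is feasible for every [mu]. *)
Lemma inverse_feasible S (T0 : 'M[R]_n) (M x : R) : 0 <= x -> n%:R * x <= 1 / 2 ->
  row_l1_le T0 M -> (forall i j, `|(T0 *m S - 1%:M) i j| <= x) ->
  S \in unitmx /\ row_l1_le (invmx S) (2 * M).
Proof.
move=> x0 nx hT0 hE; set E := T0 *m S - 1%:M in hE.
have colE (v : 'cV[R]_n) : S *m v = 0 -> v = 0.
  move=> Sv; have Ev : v = - (E *m v).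
    by rewrite /E mulmxBl -mulmxA Sv mulmx0 mul1mx sub0r opprK.
  have nv : norm1 v <= 1 / 2 * norm1 v.
    rewrite {1}norm1_cV (@le_trans _ _ (\sum_(i < n) x * norm1 v))//.
      apply: ler_sum => i _; rewrite {1}Ev mxE normrN mxE.
      rewrite norm1_cV mulr_sumr (le_trans (ler_norm_sum _ _ _))//.
      by apply: ler_sum => j _; rewrite normrM ler_wpM2r.
    rewrite sumr_const card_ord -[leLHS]mulr_natl mulrA ler_wpM2r ?norm1_ge0//.
  have v0 : norm1 v = 0 by have := norm1_ge0 v; lra.
  apply/sqnorm2_eq0/eqP; rewrite eq_le sqnorm2_ge0 andbT.
  rewrite sqnorm2E (le_trans (ler_norm _))//.
  rewrite (le_trans (@ler_dot _ _ v v (mx_norm v) _))//.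
    by move=> i; exact: mx_norm_entry.
  by rewrite v0 mulr0.
have Su : S \in unitmx.
  rewrite -unitmx_tr -row_free_unit -kermx_eq0; apply/eqP/row_matrixP => i.
  rewrite row0; apply: trmx_inj; rewrite trmx0; apply: colE.
  have -> : S *m (row i (kermx S^T))^T = (row i (kermx S^T) *m S^T)^T.
    by rewrite trmx_mul trmxK.
  by rewrite -row_mul mulmx_ker row0 trmx0.
split=> // i; set V := invmx S.
have VE : V = T0 - E *m V.
  by rewrite /E mulmxBl -mulmxA mulmxV// mulmx1 mul1mx opprB addrC subrK.
have rowb a : \sum_j `|V a j| <= M + x * norm1 V.
  rewrite {1}VE (@le_trans _ _ (\sum_j (`|T0 a j| + `|(E *m V) a j|)))//.
    apply: ler_sum => j _; rewrite mxE (le_trans (ler_normD _ _))// mxE normrN//.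
  rewrite big_split/=; apply: lerD => //.
  rewrite /norm1 mulr_sumr (@le_trans _ _ (\sum_j \sum_l x * `|V l j|))//.
    apply: ler_sum => j _; rewrite mxE (le_trans (ler_norm_sum _ _ _))//.
    by apply: ler_sum => l _; rewrite normrM ler_wpM2r.
  by rewrite exchange_big/=; apply: ler_sum => l _; rewrite mulr_sumr.
have nV : norm1 V <= n%:R * (M + x * norm1 V).
  rewrite {1}/norm1 (@le_trans _ _ (\sum_(a < n) (M + x * norm1 V)))//.
    by apply: ler_sum => a _.
  by rewrite sumr_const card_ord -[leLHS]mulr_natl.
have V0 := norm1_ge0 V.
have : x * norm1 V <= x * (n%:R * (M + x * norm1 V)) by rewrite ler_wpM2l.
have M0 : 0 <= M by rewrite (le_trans _ (hT0 i))// sumr_ge0.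
have : n%:R * x * (M + x * norm1 V) <= 1 / 2 * (M + x * norm1 V).
  by rewrite ler_wpM2r// addr_ge0// mulr_ge0.
move=> h3; rewrite mulrA (mulrC x) => h4.
by apply: (le_trans (rowb i)); lra.
Qed.

End clime.

(** * Measurability of matrix-valued maps *)

Section mx_measurability.
Context {R : realType}.

Lemma measurable_entry m n (i : 'I_m) (j : 'I_n) :
  measurable_fun [set: 'M[R]_(m, n)] (fun A : 'M[R]_(m, n) => A i j).
Proof.
move=> _ B mB; rewrite setTI; apply: sub_sigma_algebra.
by exists (i, j) => //; exists B => //; rewrite setTI.
Qed.

Lemma measurable_mxP d (T : measurableType d) m n (f : T -> 'M[R]_(m, n)) :
  (forall i j, measurable_fun [set: T] (fun w => f w i j)) ->
  measurable_fun [set: T] f.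
Proof.
move=> mf; pose G : set_system 'M[R]_(m, n) :=
  \bigcup_(ij in [set: 'I_m * 'I_n])
    preimage_set_system [set: 'M[R]_(m, n)]
      (fun A => A ij.1 ij.2) (@measurable _ R).
apply: (@measurability _ _ _ _ _ _ G) => // _ [_ [ij _ [B mB <-]] <-].
by have := mf ij.1 ij.2 measurableT B mB; rewrite !setTI.
Qed.

Lemma measurable_mx_entry d (T : measurableType d) m n (f : T -> 'M[R]_(m, n))
    i j :
  measurable_fun [set: T] f -> measurable_fun [set: T] (fun w => f w i j).
Proof. by move=> mf; exact: (measurableT_comp (measurable_entry i j) mf). Qed.

Section ops.
Context {d} {T : measurableType d}.

Lemma measurable_mxD m n (f g : T -> 'M[R]_(m, n)) : measurable_fun setT f ->
  measurable_fun setT g -> measurable_fun setT (fun w => f w + g w).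
Proof.
move=> mf mg; apply: measurable_mxP => i j; under eq_fun do rewrite mxE.
by apply: measurable_funD; exact: measurable_mx_entry.
Qed.

Lemma measurable_mxZ m n a (f : T -> 'M[R]_(m, n)) : measurable_fun setT f ->
  measurable_fun setT (fun w => a *: f w).
Proof.
move=> mf; apply: measurable_mxP => i j; under eq_fun do rewrite mxE.
by apply: measurable_funM => //; exact: measurable_mx_entry.
Qed.

Lemma measurable_mxB m n (f g : T -> 'M[R]_(m, n)) : measurable_fun setT f ->
  measurable_fun setT g -> measurable_fun setT (fun w => f w - g w).
Proof.
move=> mf mg; apply: measurable_mxD => //.
by under eq_fun do rewrite -scaleN1r; exact: measurable_mxZ.
Qed.

Lemma measurable_mxT m n (f : T -> 'M[R]_(m, n)) : measurable_fun setT f ->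
  measurable_fun setT (fun w => (f w)^T).
Proof.
move=> mf; apply: measurable_mxP => i j; under eq_fun do rewrite mxE.
exact: measurable_mx_entry.
Qed.

Lemma measurable_mxM m n p (f : T -> 'M[R]_(m, n)) (g : T -> 'M[R]_(n, p)) :
  measurable_fun setT f -> measurable_fun setT g ->
  measurable_fun setT (fun w => f w *m g w).
Proof.
move=> mf mg; apply: measurable_mxP => i j; under eq_fun do rewrite mxE.
by apply: measurable_sum => l; apply: measurable_funM; exact: measurable_mx_entry.
Qed.

Lemma measurable_mx_row m n (f : T -> 'M[R]_(m, n)) i : measurable_fun setT f ->
  measurable_fun setT (fun w => row i (f w)).
Proof.
move=> mf; apply: measurable_mxP => a b; under eq_fun do rewrite mxE.
exact: measurable_mx_entry.
Qed.

Lemma measurable_dot m (f g : T -> 'cV[R]_m) : measurable_fun setT f ->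
  measurable_fun setT g -> measurable_fun setT (fun w => dot (f w) (g w)).
Proof.
move=> mf mg; under eq_fun do rewrite dotE.
by apply: measurable_mx_entry; apply: measurable_mxM => //; exact: measurable_mxT.
Qed.

Lemma measurable_mx_norm_gt m n (f : T -> 'M[R]_(m, n)) x :
  measurable_fun setT f -> measurable [set w | x < mx_norm (f w)].
Proof.
move=> mf; have [x0|x0] := ltP x 0.
  rewrite [X in measurable X](_ : _ = setT)//; apply/seteqP; split=> // w _ /=.
  exact: lt_le_trans (mx_norm_ge0 _).
rewrite [X in measurable X](_ : _ =
    ~` \bigcap_(i in [set: 'I_m]) \bigcap_(j in [set: 'I_n])
         [set w | `|f w i j| <= x]).
  apply: measurableC; apply: fin_bigcap_measurable => // i _.
  apply: fin_bigcap_measurable => // j _; rewrite -[X in measurable X]setTI.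
  apply: measurable_fun_le => //; apply: measurableT_comp => //.
  exact: measurable_mx_entry.
apply/seteqP; split=> w /=.
  move=> + h; rewrite ltNge => /negP; apply; apply/(mx_norm_leP _ x0) => i j.
  exact: h.
move=> h; rewrite ltNge; apply/negP => /(mx_norm_leP _ x0) h'; apply: h => i _ j _.
exact: h'.
Qed.

End ops.
End mx_measurability.

(** * Independence *)

Section independence.
Context {R : realType}.
Local Open Scope ereal_scope.

Section pair.
Context d (T : measurableType d) (P : probability T R).
Context d1 d2 (T1 : measurableType d1) (T2 : measurableType d2).
Variables (Y : {RV P >-> T1}) (Z : {RV P >-> T2}).
Hypothesis YZ : independent_rv P Y Z.

Let pairYZ : T -> T1 * T2 := fun w => (Y w, Z w).
Let mpair : measurable_fun [set: T] pairYZ.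
Proof. by apply/measurable_fun_pairP; split. Qed.
HB.instance Definition _ := isMeasurableFun.Build _ _ _ _ pairYZ mpair.

(** The joint law is the product of the marginal laws, since both agree on
    rectangles; evaluating the product law section by section gives the formula. *)
Lemma independent_joint_law (A : set (T1 * T2)) : measurable A ->
  P [set w | A (Y w, Z w)] = \int[P]_w distribution P Z (xsection A (Y w)).
Proof.
move=> mA.
have -> : P [set w | A (Y w, Z w)] = distribution P pairYZ A by [].
rewrite -(@product_measure_unique _ _ _ _ _ (distribution P Y) (distribution P Z))//.
rewrite /product_measure1 ge0_integral_distribution//.
exact: measurable_fun_xsection.
Qed.

Lemma independent_expectation (f : T1 -> \bar R) (g : T2 -> \bar R) :
  measurable_fun setT f -> measurable_fun setT g ->
  (forall y, 0 <= f y) -> (forall z, 0 <= g z) ->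
  \int[P]_w (f (Y w) * g (Z w)) = \int[P]_w f (Y w) * \int[P]_w g (Z w).
Proof.
move=> mf mg f0 g0.
pose h (p : T1 * T2) := f p.1 * g p.2.
have mh : measurable_fun setT h.
  by apply: emeasurable_funM; exact: measurableT_comp.
have h0 p : 0 <= h p by exact: mule_ge0.
transitivity (\int[distribution P pairYZ]_p h p).
  by rewrite ge0_integral_distribution.
rewrite -(@eq_measure_integral _ _ _ _ (distribution P pairYZ)
  ((distribution P Y) \x (distribution P Z))); last first.
  by move=> A mA _; exact: product_measure_unique.
rewrite fubini_tonelli1//; transitivity
  (\int[distribution P Y]_y (f y * \int[P]_w g (Z w))).
  apply: eq_integral => y _; rewrite /fubini_F /h /= ge0_integralZl//.
  by rewrite ge0_integral_distribution.
rewrite ge0_integralZr ?integral_ge0// ge0_integral_distribution//.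
Qed.

End pair.
End independence.

Section rows.
Context {R : realType}.
Local Open Scope ereal_scope.

(** Coordinate preimages are intersections of row conditions, so the sets cut
    out by measurable conditions on the rows form a pi-system that generates
    the Borel sets of matrices. *)
Definition row_rectangles N n : set_system 'M[R]_(N, n) :=
  [set B | exists2 C : 'I_N -> set 'rV[R]_n, forall i, measurable (C i) &
           B = [set A | forall i, C i (row i A)]].

Lemma row_rectangles_generate N n :
  @measurable _ 'M[R]_(N, n) = <<s @row_rectangles N n >>.
Proof.
apply/seteqP; split.
  apply: smallest_sub; first exact: smallest_sigma_algebra.
  move=> _ [[a b] _ [B mB <-]]; apply: sub_sigma_algebra.
  exists (fun i => if i == a then [set r : 'rV_n | B (r ord0 b)] else setT).
    move=> i; case: ifP => // _.
    by have := measurable_entry (@ord0 0) b measurableT mB; rewrite setTI.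
  rewrite setTI; apply/seteqP; split => A /=.
    by move=> BA i; case: ifP => // /eqP ->; rewrite /= mxE.
  by move=> /(_ a); rewrite eqxx /= mxE.
apply: smallest_sub; first exact: sigma_algebra_measurable.
move=> _ [C mC ->].
rewrite [X in measurable X](_ : _ =
  \bigcap_(i in [set: 'I_N]) (row i @^-1` C i)).
  apply: fin_bigcap_measurable => // i _; rewrite -[X in measurable X]setTI.
  by apply: measurable_mx_row => //; exact: measurable_id.
by apply/seteqP; split => A /= h i; [move=> _|]; exact: h.
Qed.

Section fixed.
Context d (T : measurableType d) (P : probability T R) (N n : nat).
Variable X : {RV P >-> 'M[R]_(N, n)}.
Hypothesis iX : independent_rows P X.

(** Rows [j] and above are replaced by zero: this encodes the first [j] rows
    of [X] without changing the type. *)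
Definition prefix_rows (j : nat) (w : T) : 'M[R]_(N, n) :=
  \matrix_(i, l) if (i < j)%N then X w i l else 0%R.

Lemma measurable_prefix_rows j : measurable_fun setT (prefix_rows j).
Proof.
apply: measurable_mxP => i l; rewrite /prefix_rows.
under eq_fun do rewrite mxE.
by have [ij|ij] := ltnP i j; [exact: measurable_mx_entry|exact: measurable_cst].
Qed.

Definition matrix_row (j : 'I_N) (w : T) := row j (X w).

Lemma measurable_matrix_row j : measurable_fun setT (matrix_row j).
Proof. exact: measurable_mx_row. Qed.

HB.instance Definition _ j :=
  @isMeasurableFun.Build _ _ T 'M[R]_(N, n) (prefix_rows j) (measurable_prefix_rows j).
HB.instance Definition _ j :=
  @isMeasurableFun.Build _ _ T 'rV[R]_n (matrix_row j) (measurable_matrix_row j).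

Lemma row_prefix_rows j w (i : 'I_N) :
  row i (prefix_rows j w) = if (i < j)%N then row i (X w) else 0%R.
Proof. by apply/rowP => l; case: ifP => ij; rewrite !mxE ij// mxE. Qed.

(** For a fixed event on row [j], both sides of the product rule are finite
    measures in the event on the preceding rows.  They agree on row rectangles,
    where the hypothesis on the rows applies. *)
Lemma prefix_rows_independent (j : 'I_N) :
  independent_rv P (prefix_rows j) (matrix_row j).
Proof.
move=> A D mA mD.
have mD' : measurable (matrix_row j @^-1` D).
  by rewrite -[X in measurable X]setTI; exact: measurable_matrix_row.
have PD : P (matrix_row j @^-1` D) \is a fin_num by exact: fin_num_measure.
pose p := fine (P (matrix_row j @^-1` D)).
have p0 : (0 <= p)%R by exact: fine_ge0.
pose m1 := pushforward (mrestr P mD') (prefix_rows j).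
pose m2 := mscale (NngNum p0) (distribution P (prefix_rows j)).
suff : m1 A = m2 A.
  rewrite /m1 /m2 /mscale /distribution /pushforward /mrestr/= => ->.
  by rewrite fineK// muleC.
apply: (@measure_unique _ _ _ (@row_rectangles N n) (fun=> setT)) => //.
- exact: row_rectangles_generate.
- move=> _ _ [C mC ->] [C' mC' ->].
  exists (fun i => C i `&` C' i); first by move=> i; exact: measurableI.
  apply/seteqP; split => M /=; first by move=> [h h'] i; split.
  by move=> h; split => i; have [] := h i.
- move=> _; exists (fun=> setT) => //.
  by apply/seteqP; split.
- by apply/seteqP; split => // x _; exists 0%N.
- move=> _ [C mC ->]; set S := [set A0 | _].
  suff : P (prefix_rows j @^-1` S `&` matrix_row j @^-1` D) =
         P (matrix_row j @^-1` D) * P (prefix_rows j @^-1` S).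
    have pE : P (matrix_row j @^-1` D) = p%:E by rewrite fineK.
    by rewrite pE.
  (* the rows from [j] on are zero, which decides their conditions *)
  have [C0|/existsNP[i0 /not_implyP[ji Ci]]] :=
      pselect (forall i : 'I_N, (j <= i)%N -> C i 0%R); last first.
    rewrite (_ : prefix_rows j @^-1` _ = set0); first by rewrite set0I !measure0 mule0.
    apply/seteqP; split => // w /= /(_ i0).
    by rewrite row_prefix_rows ltnNge ji.
  (* the condition [F] on row [j], the conditions [C] before it, none after it *)
  pose E (F : set 'rV[R]_n) (i : 'I_N) :=
    if (i < j)%N then C i else if i == j then F else setT.
  have mE F : measurable F -> forall i, measurable (E F i).
    by move=> mF i; rewrite /E; case: ifP => // _; case: ifP.
  have EP (F : set 'rV[R]_n) w : (forall i, E F i (row i (X w))) <->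
      (forall i, C i (row i (prefix_rows j w))) /\ F (row j (X w)).
    split=> [h|[h Fj] i].
      split=> [i|]; last by have := h j; rewrite /E ltnn eqxx.
      rewrite row_prefix_rows; case: ltnP => [ij|/C0//].
      by have := h i; rewrite /E ij.
    rewrite /E; have := h i; rewrite row_prefix_rows.
    by case: ifP => // _ _; case: eqVneq => // ->.
  have prodE F : measurable F -> P [set w | forall i, E F i (row i (X w))] =
      P [set w | F (row j (X w))] *
      \prod_(i < N | i != j) P [set w | E setT i (row i (X w))].
    move=> mF; rewrite iX; last exact: mE.
    rewrite (bigD1 j)//= /E ltnn eqxx; congr (_ * _); apply: eq_bigr => i /negPf ij.
    by rewrite ij.
  have -> : prefix_rows j @^-1` S `&`
      matrix_row j @^-1` D = [set w | forall i, E D i (row i (X w))].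
    by apply/seteqP; split => w /=; rewrite EP.
  have -> : prefix_rows j @^-1` S =
      [set w | forall i, E setT i (row i (X w))].
    by apply/seteqP; split => w /=; rewrite EP => // -[].
  rewrite !prodE//.
  have -> : P [set w | setT (row j (X w))] = 1 by exact: probability_setT.
  by rewrite mul1e.
- move=> _; apply: (@le_lt_trans _ _ 1); last exact: ltry.
  by apply: probability_le1; rewrite preimage_setT setTI.
Qed.

(** Induction on the number of rows: the product over the first [j] rows is a
    function of [prefix_rows j], hence independent of row [j]. *)
Lemma independent_rows_expectation (f : 'I_N -> 'rV[R]_n -> R) :
  (forall i, measurable_fun setT (f i)) -> (forall i r, 0 <= f i r)%R ->
  \int[P]_w (\prod_(i < N) f i (row i (X w)))%:E =
  \prod_(i < N) \int[P]_w (f i (row i (X w)))%:E.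
Proof.
move=> mf f0.
suff H : forall j, (j <= N)%N ->
    \int[P]_w (\prod_(i < N | (i < j)%N) f i (row i (X w)))%:E =
    \prod_(i < N | (i < j)%N) \int[P]_w (f i (row i (X w)))%:E.
  rewrite [RHS](eq_bigl (fun i : 'I_N => i < N)%N) => [|i]; last by rewrite ltn_ord.
  rewrite -H//; apply: eq_integral => w _; congr _%:E.
  by apply: eq_bigl => i; rewrite ltn_ord.
elim=> [_|j IH jN].
  rewrite big_pred0//; under eq_integral do rewrite big_pred0//.
  by rewrite integral_cst// mul1e; exact: probability_setT.
pose jo := Ordinal jN.
have bj V (idx : V) (op : Monoid.com_law idx) (F : 'I_N -> V) :
    \big[op/idx]_(i < N | (i < j.+1)%N) F i =
    op (F jo) (\big[op/idx]_(i < N | (i < j)%N) F i).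
  rewrite (bigD1 jo)/= ?ltnS//; congr (op _ _); apply: eq_bigl => i.
  by rewrite ltnS (ltn_neqAle i) andbC.
rewrite bj -IH 1?ltnW//.
pose g (A : 'M[R]_(N, n)) := (\prod_(i < N | (i < j)%N) f i (row i A))%:E.
have mg : measurable_fun setT g.
  apply/measurable_EFinP; under eq_fun do rewrite -big_filter.
  apply: measurable_prod => i _; apply: (measurableT_comp (mf i)).
  exact: measurable_mx_row.
transitivity (\int[P]_w (g (prefix_rows jo w) * (f jo (matrix_row jo w))%:E)).
  apply: eq_integral => w _; rewrite bj EFinM muleC; congr (_%:E * _).
  by apply: eq_bigr => i ij; rewrite row_prefix_rows ij.
rewrite (independent_expectation (prefix_rows_independent jo) (f := g)
  (g := fun r => (f jo r)%:E))//; last 3 first.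
- exact/measurable_EFinP.
- by move=> A; rewrite lee_fin prodr_ge0.
- by move=> r; rewrite lee_fin.
rewrite muleC; congr (_ * _); apply: eq_integral => w _; congr _%:E.
by apply: eq_bigr => i ij; rewrite row_prefix_rows ij.
Qed.

End fixed.
End rows.

(** * Exponential moments *)

Section exponential_moments.
Context {R : realType}.

Lemma fact_double_le k : ((2 * k)`! <= k`! * (2 * k) ^ k)%N.
Proof.
have ffact_le n j : (n ^_ j <= n ^ j)%N.
  by elim: j => // j IH; rewrite ffactnSr expnSr leq_mul// leq_subr.
rewrite -(@ffact_fact (2 * k) k); last by rewrite mul2n -addnn leq_addl.
by rewrite {2}mul2n -addnn addnK mulnC leq_mul.
Qed.

Lemma expR_ge_term (x : R) k : 0 <= x -> x ^+ k / k`!%:R <= expR x.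
Proof.
move=> x0; case: k => [|k]; first by rewrite expr0 fact0 divr1 -expR0 ler_expR.
by rewrite (le_trans _ (expR_ge1Dxn k x0))// lerDr.
Qed.

Lemma expR_nneseries (x : R) : 0 <= x ->
  (expR x)%:E = (\sum_(k <oo) (x ^+ k / k`!%:R)%:E)%E.
Proof.
move=> x0; rewrite /expR -EFin_lim; last exact: is_cvg_series_exp_coeff.
apply: congr_lim; apply/funext => n /=.
by rewrite /series/= -sumEFin.
Qed.

(** For [x >= 0] apply [exp (- x) >= 1 - x] twice; for [x < 0] compare [exp x] with
    [1 / (1 - x)]. *)
Lemma expR_le2 (x : R) : expR x <= 1 + x + x ^+ 2 * expR `|x|.
Proof.
have [x0|x0] := leP 0 x.
  rewrite ger0_norm//; have e0 := expR_gt0 x.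
  have h : expR x - 1 <= x * expR x.
    have := expR_ge1Dx (- x); rewrite expRN => h.
    have : (1 - x) * expR x <= (expR x)^-1 * expR x by rewrite ler_wpM2r ?(ltW e0).
    by rewrite mulVf ?gt_eqF// => {}h; lra.
  have : x * (expR x - 1) <= x * (x * expR x) by rewrite ler_wpM2l.
  by rewrite expr2; lra.
rewrite ltr0_norm//; have := expR_ge1Dx (- x) => h.
have e0 := expR_gt0 (- x).
have xE : expR x = (expR (- x))^-1 by rewrite expRN invrK.
have x1 : 0 < 1 - x by lra.
have : expR x <= (1 - x)^-1 by rewrite xE lef_pV2 ?posrE.
have : (1 - x)^-1 <= 1 + x + x ^+ 2.
  rewrite -[leLHS]mul1r ler_pdivrMr//; nra.
have : x ^+ 2 * 1 <= x ^+ 2 * expR (- x).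
  by rewrite ler_wpM2l ?sqr_ge0//; lra.
lra.
Qed.

(** Integrated in [y], this bounds the moment generating function near zero by its
    first order expansion plus [s^2] times one exponential moment of [|y|]. *)
Lemma expR_le_mgf (theta s y : R) : 0 < theta -> `|s| <= theta / 2 ->
  expR (s * y) <= 1 + s * y + 16 * s ^+ 2 / theta ^+ 2 * expR (theta * `|y|).
Proof.
move=> t0 st; rewrite (le_trans (expR_le2 _))// lerD2l normrM.
have y0 : 0 <= `|y| := normr_ge0 y.
set z := theta * `|y| / 2; have z0 : 0 <= z by rewrite /z divr_ge0 ?mulr_ge0 ?(ltW t0).
have hz : (z / 2) ^+ 2 <= expR z.
  have -> : expR z = expR (z / 2) ^+ 2 by rewrite expr2 -expRD; congr expR; field.
  have z2 : 0 <= z / 2 by lra.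
  by rewrite ler_sqr ?nnegrE ?expR_ge0//; have := expR_ge1Dx (z / 2); lra.
have hy : y ^+ 2 <= 16 / theta ^+ 2 * expR z.
  rewrite (_ : y ^+ 2 = 16 / theta ^+ 2 * (z / 2) ^+ 2).
    by rewrite ler_wpM2l// divr_ge0 ?sqr_ge0.
  by rewrite -(real_normK (num_real y)) /z; field; rewrite gt_eqF.
have hs : expR (`|s| * `|y|) <= expR z.
  by rewrite ler_expR /z mulrAC ler_wpM2r.
have -> : expR (theta * `|y|) = expR z * expR z.
  by rewrite -expRD; congr expR; rewrite /z; field.
have -> : 16 * s ^+ 2 / theta ^+ 2 * (expR z * expR z) =
    s ^+ 2 * ((16 / theta ^+ 2 * expR z) * expR z) by ring.
rewrite (exprMn _ s y) -(mulrA (s ^+ 2)); apply: ler_wpM2l; first exact: sqr_ge0.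
by apply: ler_pM; rewrite ?sqr_ge0 ?expR_ge0.
Qed.

Context d (T : measurableType d) (P : probability T R).
Local Open Scope ereal_scope.

(** Taylor expansion: the [k]-th term of [exp (theta a^2)] is dominated by an
    exponential moment of order [sqrt (2 k) / s], so the series of means is
    dominated by a geometric one. *)
Lemma square_mgf_le (a : T -> R) (s : R) : (0 < s)%R ->
  measurable_fun setT a ->
  (forall t, 'M_P a t <= (expR (s ^+ 2 * t ^+ 2 / 2))%:E) ->
  \int[P]_w (expR ((2 * expR 1 * s ^+ 2)^-1 * a w ^+ 2))%:E <= 4%:E.
Proof.
move=> s0 ma hM; set theta := (_^-1)%R.
have s20 : (0 < s ^+ 2)%R by rewrite exprn_gt0.
have th0 : (0 < theta)%R by rewrite invr_gt0 !mulr_gt0 ?expR_gt0.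
have habs t : \int[P]_w (expR (t * `|a w|))%:E <=
    (2 * expR (s ^+ 2 * t ^+ 2 / 2))%:E.
  have mE u : measurable_fun setT (fun w => (expR (u * a w))%:E).
    apply/measurable_EFinP; apply: measurableT_comp => //.
    exact: measurable_funM.
  apply: (@le_trans _ _ (\int[P]_w ((expR (t * a w))%:E + (expR (- t * a w))%:E))).
    apply: ge0_le_integral => //.
    - apply/measurable_EFinP; apply: measurableT_comp => //.
      by apply: measurable_funM => //; exact: measurableT_comp.
    - exact: emeasurable_funD.
    - move=> w _; rewrite -EFinD lee_fin.
      have [a0|a0] := leP 0%R (a w).
        by rewrite ger0_norm// lerDl expR_ge0.
      by rewrite ltr0_norm// mulNr mulrN lerDr expR_ge0.
  rewrite ge0_integralD//.
  rewrite mulr_natl mulr2n EFinD; apply: leeD.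
    have := hM t; rewrite /mmt_gen_fun unlock; apply: le_trans.
    by rewrite le_eqVlt; apply/orP; left; apply/eqP; apply: eq_integral => w _ /=; rewrite mulrC.
  have := hM (- t)%R; rewrite /mmt_gen_fun unlock sqrrN; apply: le_trans.
  by rewrite le_eqVlt; apply/orP; left; apply/eqP; apply: eq_integral => w _ /=; rewrite mulrC.
have term k : \int[P]_w (((theta * a w ^+ 2) ^+ k / k`!%:R)%R)%:E <=
    (2 * (2^-1) ^+ k)%:E.
  pose t := (Num.sqrt (2 * k%:R) / s)%R.
  have t0 : (0 <= t)%R by rewrite divr_ge0 ?sqrtr_ge0 ?ltW.
  have tt : (t ^+ 2 = 2 * k%:R / s ^+ 2)%R.
    by rewrite /t exprMn exprVn sqr_sqrtr ?mulr_ge0.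
  apply: (@le_trans _ _ (\int[P]_w (((theta * s ^+ 2) ^+ k)%:E
      * (expR (t * `|a w|))%:E))).
    apply: ge0_le_integral => //.
    - by move=> w _; rewrite lee_fin divr_ge0// exprn_ge0// mulr_ge0 ?sqr_ge0 ?ltW.
    - apply/measurable_EFinP; apply: measurable_funM => //.
      apply: measurable_funX; apply: measurable_funM => //.
      exact: measurable_funX.
    - apply: emeasurable_funM => //; apply/measurable_EFinP.
      apply: measurableT_comp => //; apply: measurable_funM => //.
      exact: measurableT_comp.
    - move=> w _; rewrite -EFinM lee_fin.
      have := @expR_ge_term (t * `|a w|) (2 * k) (mulr_ge0 t0 (normr_ge0 _)).
      rewrite (exprM _ 2 k) (exprMn 2 t) tt real_normK ?num_real// => h.
      apply: le_trans (ler_wpM2l _ h); last first.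
        by rewrite exprn_ge0// mulr_ge0 ?ltW.
      have f1 : (0 < k`!%:R :> R)%R by rewrite ltr0n fact_gt0.
      have f2 : (0 < (2 * k)`!%:R :> R)%R by rewrite ltr0n fact_gt0.
      have -> : ((theta * s ^+ 2) ^+ k * ((2 * k%:R / s ^+ 2 * a w ^+ 2) ^+ k
          / (2 * k)`!%:R) = (theta * a w ^+ 2) ^+ k * ((2 * k%:R) ^+ k / (2 * k)`!%:R))%R.
        rewrite mulrA [in RHS]mulrA -!exprMn; congr (_ ^+ _ / _)%R.
        by field; rewrite gt_eqF.
      rewrite ler_wpM2l//; first by rewrite exprn_ge0// mulr_ge0 ?sqr_ge0 ?ltW.
      rewrite ler_pdivlMr// mulrC ler_pdivrMr// mulrC -natrM -natrX -natrM ler_nat.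
      exact: fact_double_le.
  rewrite ge0_integralZl//; last 2 first.
  - apply/measurable_EFinP; apply: measurableT_comp => //.
    by apply: measurable_funM => //; exact: measurableT_comp.
  - by rewrite lee_fin exprn_ge0// mulr_ge0 ?ltW.
  apply: (le_trans (lee_wpmul2l _ (habs t))).
    by rewrite lee_fin exprn_ge0// mulr_ge0 ?ltW.
  rewrite -EFinM lee_fin tt mulrCA ler_wpM2l//.
  have -> : (s ^+ 2 * (2 * k%:R / s ^+ 2) / 2 = 1 * k%:R)%R.
    by field; rewrite gt_eqF.
  rewrite expRM_natr -exprMn /theta.
  rewrite (_ : (_^-1 * s ^+ 2 * expR 1 = 2^-1)%R)//.
  by field; rewrite !gt_eqF ?expR_gt0.
have -> : \int[P]_w (expR (theta * a w ^+ 2))%:E =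
    \int[P]_w (\sum_(k <oo) (((theta * a w ^+ 2) ^+ k / k`!%:R)%R)%:E).
  apply: eq_integral => w _; apply: expR_nneseries.
  by rewrite mulr_ge0 ?sqr_ge0 ?ltW.
have t_ge0 k w : 0 <= (((theta * a w ^+ 2) ^+ k / k`!%:R)%R)%:E.
  by rewrite lee_fin divr_ge0// exprn_ge0// mulr_ge0 ?sqr_ge0 ?ltW.
rewrite integral_nneseries//; last first.
  move=> k; apply/measurable_EFinP; apply: measurable_funM => //.
  apply: measurable_funX; apply: measurable_funM => //.
  exact: measurable_funX.
apply: lime_le.
  by apply: is_cvg_nneseries => k _ _; apply: integral_ge0.
apply: nearW => m; apply: (@le_trans _ _ (\sum_(0 <= k < m) (2 * (2^-1) ^+ k)%:E)).
  by apply: lee_sum => k _; exact: term.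
rewrite sumEFin lee_fin.
have -> : (\sum_(0 <= k < m) 2 * 2^-1 ^+ k = 4 - 4 * 2^-1 ^+ m :> R)%R.
  elim: m => [|m IH]; first by rewrite big_nil expr0; ring.
  by rewrite big_nat_recr//= IH exprS; field.
by rewrite gerBl mulr_ge0// exprn_ge0.
Qed.

End exponential_moments.

(** * Concentration of the sample covariance matrix *)

Section sample_covariance.
Context {R : realType} d (T : measurableType d) (P : probability T R).
Context (N n : nat) (X : {RV P >-> 'M[R]_(N, n)}) (Sigma : 'M[R]_n) (sigma : R).
Hypothesis sigma0 : 0 < sigma.
Hypothesis hX : rowwise_subgaussian P sigma Sigma X.
Local Open Scope ereal_scope.

Definition row_functional (l : 'I_N) (u : 'cV[R]_n) (w : T) : R :=
  (X w *m u) l ord0.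

Lemma row_functionalE l u w :
  row_functional l u w = (row l (X w) *m u) ord0 ord0.
Proof. by rewrite -row_mul [RHS]mxE. Qed.

Lemma measurable_row_functional l u : measurable_fun setT (row_functional l u).
Proof.
by apply: measurable_mx_entry; apply: measurable_mxM => //; exact: measurable_cst.
Qed.

(** The hypothesis concerns unit vectors; other directions follow by rescaling the
    argument of the moment generating function. *)
Lemma row_functional_mgf l u (rho : R) : (0 < rho)%R ->
  (sqnorm2 u <= rho ^+ 2)%R -> forall t,
  'M_P (row_functional l u) t <= (expR ((sigma * rho) ^+ 2 * t ^+ 2 / 2))%:E.
Proof.
move=> rho0 urho t; have [_ _ hsub _] := hX.
have [u0|u0] := eqVneq u 0%R.
  rewrite /mmt_gen_fun (_ : expR \o _ = cst 1%R); last first.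
    apply/funext => w /=.
    by rewrite /row_functional u0 mulmx0 mxE mul0r expR0.
  rewrite expectation_cst lee_fin -[X in (X <= _)%R]expR0 ler_expR.
  by rewrite divr_ge0// mulr_ge0// sqr_ge0.
pose q := Num.sqrt (sqnorm2 u).
have q0 : (0 < q)%R.
  rewrite sqrtr_gt0 lt_def sqnorm2_ge0 andbT.
  by apply: contra_neq u0 => /sqnorm2_eq0.
have qq : (q ^+ 2 = sqnorm2 u)%R by rewrite sqr_sqrtr// sqnorm2_ge0.
have uq : (sqnorm2 (q^-1 *: u) = 1)%R.
  by rewrite sqnorm2Z exprVn qq mulVf// -qq gt_eqF// exprn_gt0.
have [_ /(_ (t * q)%R)] := (hsub l).2 _ uq.
rewrite /mmt_gen_fun (_ : (expR \o _) = (expR \o t \o* row_functional l u)); last first.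
  apply/funext => w /=; rewrite row_functionalE -scalemxAr mxE; congr expR.
  by rewrite -row_functionalE; field; rewrite gt_eqF.
move=> /le_trans; apply; rewrite lee_fin ler_expR ler_pM2r// !exprMn qq mulrA.
by rewrite mulrAC ler_wpM2r ?sqr_ge0// ler_wpM2l// sqr_ge0.
Qed.

Section product.
Context (u v : 'cV[R]_n) (rho : R).
Hypotheses (rho0 : (0 < rho)%R).
Hypotheses (hu : (sqnorm2 u <= rho ^+ 2)%R) (hv : (sqnorm2 v <= rho ^+ 2)%R).
Let theta := ((2 * expR 1 * (sigma * rho) ^+ 2)^-1)%R.

Let theta0 : (0 < theta)%R.
Proof. by rewrite invr_gt0 !mulr_gt0 ?expR_gt0 ?exprn_gt0 ?mulr_gt0. Qed.

Let prod l w : R := row_functional l u w * row_functional l v w.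

Let mprod l : measurable_fun setT (prod l).
Proof. by apply: measurable_funM; exact: measurable_row_functional. Qed.

(** By [2 x y <= x^2 + y^2] and convexity, the exponential of the product is at most
    the mean of the exponentials of the two squares. *)
Lemma row_product_mgf l :
  \int[P]_w (expR (theta * `|row_functional l u w * row_functional l v w|))%:E
  <= 4%:E.
Proof.
have msq z : measurable_fun setT
    (fun w => (expR (theta * row_functional l z w ^+ 2))%:E).
  apply/measurable_EFinP; apply: measurableT_comp => //.
  apply: measurable_funM => //; apply: measurable_funX.
  exact: measurable_row_functional.
have hz z : (sqnorm2 z <= rho ^+ 2)%R ->
    \int[P]_w (expR (theta * row_functional l z w ^+ 2))%:E <= 4%:E.
  move=> hz; apply: square_mgf_le; first exact: mulr_gt0.
    exact: measurable_row_functional.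
  exact: row_functional_mgf.
apply: (@le_trans _ _ (\int[P]_w (2^-1%:E *
   ((expR (theta * row_functional l u w ^+ 2))%:E +
    (expR (theta * row_functional l v w ^+ 2))%:E)))).
  apply: ge0_le_integral => //.
  - apply/measurable_EFinP; apply: measurableT_comp => //.
    by apply: measurable_funM => //; apply: measurableT_comp => //; exact: mprod.
  - by apply: emeasurable_funM => //; exact: emeasurable_funD.
  - move=> w _; rewrite -EFinD -EFinM lee_fin normrM.
    set a := row_functional l u w; set b := row_functional l v w.
    rewrite -(real_normK (num_real a)) -(real_normK (num_real b)).
    move: (normr_ge0 a) (normr_ge0 b); move: `|a|%R `|b|%R => x y x0 y0.
    apply: (@le_trans _ _ (expR (theta * x ^+ 2 / 2) * expR (theta * y ^+ 2 / 2))%R).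
      rewrite -expRD ler_expR -mulrDl -mulrDr -mulrA ler_pM2l//.
      have := sqr_ge0 (x - y); lra.
    have half z : expR (theta * z ^+ 2) = (expR (theta * z ^+ 2 / 2) ^+ 2)%R.
      by rewrite [RHS]expr2 -expRD; congr expR; field.
    rewrite !half; move: (expR _) (expR _) => p q.
    have := sqr_ge0 (p - q); lra.
rewrite ge0_integralZl//; last 2 first.
- by apply: emeasurable_funD.
- by move=> w _; rewrite adde_ge0.
rewrite ge0_integralD//.
rewrite (_ : 4%:E = 2^-1%:E * (4 + 4)%:E); last by rewrite -EFinM; congr _%:E; field.
by rewrite lee_wpmul2l// ?lee_fin// EFinD leeD// hz.
Qed.

Lemma integrable_row_product l : P.-integrable setT
  (EFin \o (fun w => row_functional l u w * row_functional l v w)%R).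
Proof.
apply/integrableP; split; first by apply/measurable_EFinP; exact: mprod.
apply: (@le_lt_trans _ _ (\int[P]_w ((theta^-1)%:E *
    (expR (theta * `|row_functional l u w * row_functional l v w|))%:E))).
  have me : measurable_fun setT (fun w =>
      (expR (theta * `|row_functional l u w * row_functional l v w|))%:E).
    apply/measurable_EFinP; apply: measurableT_comp => //.
    by apply: measurable_funM => //; apply: measurableT_comp => //; exact: mprod.
  apply: ge0_le_integral => //.
  - by apply/measurable_EFinP; apply: measurableT_comp => //; exact: mprod.
  - exact: emeasurable_funM.
  - move=> w _; rewrite -EFinM lee_fin ler_pdivlMl//.
    by rewrite (le_trans _ (expR_ge1Dx _))// lerDr.
rewrite ge0_integralZl//; last 2 first.
- apply/measurable_EFinP; apply: measurableT_comp => //.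
  by apply: measurable_funM => //; apply: measurableT_comp => //; exact: mprod.
- by rewrite lee_fin invr_ge0 ltW.
apply: lte_mul_pinfty => //; first by rewrite lee_fin invr_ge0 ltW.
exact: le_lt_trans (row_product_mgf l) (ltry _).
Qed.

End product.

Lemma row_entry_moment l j j' :
  \int[P]_w (X w l j * X w l j')%:E = (Sigma j j')%:E.
Proof.
have [_ _ hsub hcov] := hX; rewrite -(hcov l).
have E0 i : 'E_P[fun w => X w l i] = 0.
  rewrite -[RHS]((hsub l).1 i).
  by congr expectation; apply/funext => w; rewrite mxE.
rewrite unlock !E0 /= unlock; apply: eq_integral => w _ /=.
by rewrite [in RHS](_ : (_ * _) w = (X w l j - 0) * (X w l j' - 0))%R// !subr0.
Qed.

Lemma row_product_mean l u v :
  \int[P]_w (row_functional l u w * row_functional l v w)%:E =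
  (dot u (Sigma *m v))%:E.
Proof.
have mX j : X ^~ l ^~ j = row_functional l (delta_mx j ord0).
  by apply/funext => w; rewrite /row_functional mulmx_delta.
have intX j j' : P.-integrable setT (EFin \o (fun w => X w l j * X w l j')%R).
  have hd i : (sqnorm2 (delta_mx i 0 : 'cV[R]_n) <= 1 ^+ 2)%R.
    by rewrite sqnorm2_delta expr1n.
  have := @integrable_row_product _ _ _ ltr01 (hd j) (hd j') l.
  by under eq_fun do rewrite /row_functional !mulmx_delta.
transitivity (\int[P]_w \sum_j \sum_j'
    (u j ord0 * v j' ord0)%:E * (X w l j * X w l j')%:E).
  apply: eq_integral => w _; rewrite /row_functional !mxE mulr_suml -sumEFin.
  apply: eq_bigr => j _; rewrite mulr_sumr -sumEFin; apply: eq_bigr => j' _.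
  by rewrite -EFinM; congr _%:E; ring.
rewrite integral_sum//; last first.
  move=> j; apply: integrable_sum => // j' _.
  by apply: integrableZl => //; exact: intX.
rewrite /dot -sumEFin; apply: eq_bigr => j _.
rewrite mxE mulr_sumr -sumEFin integral_sum//; last first.
  by move=> j'; apply: integrableZl => //; exact: intX.
apply: eq_bigr => j' _; rewrite integralZl//; last exact: intX.
by rewrite row_entry_moment -EFinM; congr _%:E; ring.
Qed.

Section tail.
Context (u v : 'cV[R]_n) (rho : R).
Hypotheses (rho0 : (0 < rho)%R).
Hypotheses (hu : (sqnorm2 u <= rho ^+ 2)%R) (hv : (sqnorm2 v <= rho ^+ 2)%R).
Let theta := ((2 * expR 1 * (sigma * rho) ^+ 2)^-1)%R.

Let theta0 : (0 < theta)%R.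
Proof. by rewrite invr_gt0 !mulr_gt0 ?expR_gt0 ?exprn_gt0 ?mulr_gt0. Qed.

Lemma row_product_mgf_centered l s : (`|s| <= theta / 2)%R ->
  \int[P]_w (expR (s * (row_functional l u w * row_functional l v w)))%:E <=
  (expR (s * dot u (Sigma *m v) + 64 * s ^+ 2 / theta ^+ 2))%:E.
Proof.
move=> st; set Y := fun w => (row_functional l u w * row_functional l v w)%R.
have mY : measurable_fun setT Y.
  by apply: measurable_funM; exact: measurable_row_functional.
have me c : measurable_fun setT (fun w => (expR (c * `|Y w|))%:E).
  apply/measurable_EFinP; apply: measurableT_comp => //.
  by apply: measurable_funM => //; exact: measurableT_comp.
have iY : P.-integrable setT (EFin \o Y).
  exact: (integrable_row_product rho0 hu hv).
have c0 : (0 <= 16 * s ^+ 2 / theta ^+ 2)%R.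
  by rewrite divr_ge0 ?sqr_ge0// mulr_ge0// sqr_ge0.
have he := row_product_mgf rho0 hu hv l.
have ie : P.-integrable setT (fun w => (expR (theta * `|Y w|))%:E).
  apply/integrableP; split => //.
  rewrite (eq_integral (fun w => (expR (theta * `|Y w|))%:E)); last first.
    by move=> w _; rewrite gee0_abs// lee_fin expR_ge0.
  exact: le_lt_trans he (ltry _).
apply: (@le_trans _ _ (\int[P]_w (1%:E + s%:E * (EFin \o Y) w +
    (16 * s ^+ 2 / theta ^+ 2)%:E * (expR (theta * `|Y w|))%:E))).
  apply: ge0_le_integral => //.
  - by apply/measurable_EFinP; apply: measurableT_comp => //; exact: measurable_funM.
  - apply: emeasurable_funD; last exact: emeasurable_funM.
    apply: emeasurable_funD => //; apply: emeasurable_funM => //.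
    exact/measurable_EFinP.
  - by move=> w _; rewrite /= -!EFinM -!EFinD lee_fin expR_le_mgf.
rewrite integralD//; last 2 first.
- apply: integrableD => //; last exact: integrableZl.
  by apply: finite_measure_integrable_cst.
- exact: integrableZl.
rewrite integralD//; last 2 first.
- by apply: finite_measure_integrable_cst.
- exact: integrableZl.
rewrite integral_cst// !integralZl// row_product_mean.
rewrite [X in 1 * X](_ : _ = 1); last exact: probability_setT.
rewrite mule1; apply: (@le_trans _ _ (1 + s%:E * (dot u (Sigma *m v))%:E +
   (16 * s ^+ 2 / theta ^+ 2)%:E * 4%:E)).
  by rewrite leeD2l// lee_wpmul2l// lee_fin.
rewrite -!EFinM -!EFinD lee_fin (le_trans _ (expR_ge1Dx _))//.
by rewrite le_eqVlt; apply/orP; left; apply/eqP; field; rewrite gt_eqF.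
Qed.

(** Chernoff's bound.  The other tail is the same bound for [- u]. *)
Lemma sample_cov_tail (t : R) : (0 < N)%N -> (0 < t)%R -> (t * theta <= 64)%R ->
  P [set w | t <= dot u (sample_cov (X w) *m v) - dot u (Sigma *m v)]%R <=
  (expR (- (N%:R * (t ^+ 2 * theta ^+ 2 / 256))))%:E.
Proof.
move=> N0 t0 tt; have NR0 : (0 < N%:R :> R)%R by rewrite ltr0n.
pose m := dot u (Sigma *m v).
pose Z w := (\sum_(l < N) row_functional l u w * row_functional l v w)%R.
have mZ : measurable_fun setT Z.
  by apply: measurable_sum => l; apply: measurable_funM; exact: measurable_row_functional.
pose Zm : {mfun T >-> R} := HB.pack Z (isMeasurableFun.Build _ _ _ _ Z mZ).
have ZE w : (dot u (sample_cov (X w) *m v) = N%:R^-1 * Z w)%R.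
  rewrite /sample_cov -scalemxAl dotZr -mulmxA dot_mulmx trmxK; congr (_ * _)%R.
(* the minimiser of [64 s^2 / theta^2 - s t], which is [- t^2 theta^2 / 256] there *)
pose s := (t * theta ^+ 2 / 128)%R.
have s0 : (0 < s)%R by rewrite divr_gt0// mulr_gt0// exprn_gt0.
have sth : (`|s| <= theta / 2)%R.
  rewrite gtr0_norm// /s expr2 mulrA.
  have := ler_wpM2r (ltW theta0) tt; lra.
have -> : [set w | t <= dot u (sample_cov (X w) *m v) - m]%R =
          [set w | N%:R * (m + t) <= Zm w]%R.
  apply/seteqP; split => w /=; rewrite ZE /= lerBrDr addrC.
    by rewrite ler_pdivlMl.
  by rewrite ler_pdivlMl.
apply: le_trans (chernoff _ _ s0) _.
have -> : 'M_P Zm s = \prod_(l < N)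
    \int[P]_w (expR (s * (row_functional l u w * row_functional l v w)))%:E.
  have [iX _ _ _] := hX.
  have := independent_rows_expectation iX (f := fun=> fun r : 'rV[R]_n =>
    expR (s * ((r *m u) ord0 ord0 * (r *m v) ord0 ord0))%R).
  move=> h.
  transitivity (\int[P]_w (\prod_(i < N) expR (s * ((row i (X w) *m u) ord0 ord0 *
      (row i (X w) *m v) ord0 ord0)))%:E).
    rewrite /mmt_gen_fun expectation.unlock.
    apply: eq_integral => w _ /=; rewrite /Z mulr_suml expR_sum; congr _%:E.
    apply: eq_bigr => l _; rewrite !row_functionalE mulrC//.
  rewrite h; last first.
  - by move=> _ r; exact: expR_ge0.
  - move=> _; apply: measurableT_comp => //; apply: measurable_funM => //.
    by apply: measurable_funM; apply: measurable_mx_entry; apply: measurable_mxM.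
  apply: eq_bigr => l _; apply: eq_integral => w _.
  by rewrite -!row_functionalE.
apply: (@le_trans _ _ ((\prod_(l < N) (expR (s * m + 64 * s ^+ 2 / theta ^+ 2))%:E)
    * (expR (- (s * (N%:R * (m + t)))))%:E)).
  rewrite lee_wpmul2r ?lee_fin ?expR_ge0//.
  pose le0 (x y : \bar R) := 0 <= x /\ x <= y.
  suff [] : le0 (\prod_(l < N) \int[P]_w
      (expR (s * (row_functional l u w * row_functional l v w)))%:E)
    (\prod_(l < N) (expR (s * m + 64 * s ^+ 2 / theta ^+ 2))%:E) by [].
  apply: big_ind2 => [|x1 x2 y1 y2 [h1 h2] [h3 h4]|l _].
  - by split.
  - by split; [exact: mule_ge0|exact: lee_pmul].
  - split; last exact: row_product_mgf_centered.
    by apply: integral_ge0 => w _; rewrite lee_fin expR_ge0.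
rewrite prodEFin -EFinM lee_fin prodr_const card_ord -expRM_natl -expRD ler_expR.
rewrite /s le_eqVlt; apply/orP; left; apply/eqP; field; rewrite gt_eqF//.
Qed.

End tail.
End sample_covariance.

(** * Gaussian noise and conditional laws *)

Lemma measurable_lt_set (R : realType) d (T : measurableType d) (f g : T -> R) :
  measurable_fun setT f -> measurable_fun setT g ->
  measurable [set w | f w < g w].
Proof.
move=> mf mg; rewrite [X in measurable X](_ : _ = ~` [set w | g w <= f w]).
  apply: measurableC; rewrite -[X in measurable X]setTI.
  exact: measurable_fun_le.
by apply/seteqP; split => w /=; rewrite ltNge => /negP.
Qed.

Section gaussian_tail.
Context {R : realType}.
Local Open Scope ereal_scope.

(** On [|z| > t] the density of [N(0, v)] is at most [2 exp (- t^2 / (4 v))]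
    times the density of [N(0, 2 v)]. *)
Lemma normal_law_tail (v V t : R) : (0 <= v <= V)%R -> (0 < V)%R -> (0 <= t)%R ->
  normal_law v [set z | t < `|z|]%R <= (2 * expR (- (t ^+ 2 / (4 * V))))%:E.
Proof.
move=> /andP[v0 vV] V0 t0; rewrite /normal_law; case: eqVneq => [_|vn0].
  rewrite diracE memNset ?lee_fin ?mulr_ge0 ?expR_ge0//.
  by rewrite /= normr0; apply/negP; rewrite -leNgt.
have vp : (0 < v)%R by rewrite lt_def vn0.
set s := Num.sqrt v; have sp : (0 < s)%R by rewrite sqrtr_gt0.
have ss : (s ^+ 2 = v)%R by rewrite sqr_sqrtr.
pose s' := Num.sqrt (2 * v); have sp' : (0 < s')%R by rewrite sqrtr_gt0 mulr_gt0.
have ss' : (s' ^+ 2 = 2 * v)%R by rewrite sqr_sqrtr// mulr_ge0.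
set c := (2 * expR _)%R; have c0 : (0 <= c)%R by rewrite mulr_ge0 ?expR_ge0.
rewrite /normal_prob; set A := [set z | _].
have mA : measurable A.
  by apply: measurable_lt_set => //; exact: measurableT_comp.
apply: (@le_trans _ _ (\int[lebesgue_measure]_(x in A)
    (c%:E * (normal_pdf 0 s' x)%:E))).
  apply: ge0_le_integral => //.
  - by move=> x _; rewrite lee_fin normal_pdf_ge0.
  - by apply/measurable_EFinP; apply: measurable_funTS; exact: measurable_normal_pdf.
  - apply: emeasurable_funM => //; apply/measurable_EFinP; apply: measurable_funTS.
    exact: measurable_normal_pdf.
  - move=> x /= tx; rewrite -EFinM lee_fin !normal_pdfE ?gt_eqF//.
    rewrite /normal_fun /normal_peak subr0 ss ss'.
    have pv : (0 < v * pi *+ 2)%R by rewrite pmulrn_lgt0// mulr_gt0// pi_gt0.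
    have pv' : (0 < 2 * v * pi *+ 2)%R by rewrite pmulrn_lgt0// !mulr_gt0// pi_gt0.
    have peak : ((Num.sqrt (v * pi *+ 2))^-1 <= 2 * (Num.sqrt (2 * v * pi *+ 2))^-1)%R.
      rewrite -[leLHS]mul1r ler_pdivrMr ?sqrtr_gt0// mulrAC ler_pdivlMr ?sqrtr_gt0//.
      rewrite mul1r -[X in (_ <= X * _)%R]ger0_norm// -sqrtr_sqr -sqrtrM ?sqr_ge0//.
      by rewrite ler_wsqrtr// (mulr2n (v * pi)) (mulr2n (2 * v * pi)); lra.
    have gauss : (expR (- x ^+ 2 / (v *+ 2)) <=
        expR (- (t ^+ 2 / (4 * V))) * expR (- x ^+ 2 / (2 * v *+ 2)))%R.
      rewrite -expRD ler_expR.
      have tx2 : (t ^+ 2 <= x ^+ 2)%R.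
        by rewrite -(real_normK (num_real x)) ler_sqr ?nnegrE ?normr_ge0// ltW.
      have : (t ^+ 2 / (4 * V) <= x ^+ 2 / (4 * v))%R.
        by rewrite ler_pM ?sqr_ge0 ?invr_ge0 ?mulr_ge0 ?(ltW V0)// lef_pV2 ?posrE ?mulr_gt0// ler_pM2l.
      have -> : (- x ^+ 2 / (v *+ 2) = - (x ^+ 2 / (4 * v)) - x ^+ 2 / (4 * v))%R.
        by rewrite (mulr2n v); field; rewrite !gt_eqF// addr_gt0.
      have -> : (- x ^+ 2 / (2 * v *+ 2) = - (x ^+ 2 / (4 * v)))%R.
        by rewrite (mulr2n (2 * v)); field; rewrite !gt_eqF// addr_gt0// mulr_gt0.
      lra.
    rewrite /c; apply: (le_trans (ler_pM _ _ peak gauss)).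
    - by rewrite invr_ge0 sqrtr_ge0.
    - exact: expR_ge0.
    - by rewrite le_eqVlt; apply/orP; left; apply/eqP; ring.
apply: (@le_trans _ _ (\int[lebesgue_measure]_x
    (c%:E * (normal_pdf 0 s' x)%:E))).
  apply: ge0_subset_integral => //.
  - apply: emeasurable_funM => //; apply/measurable_EFinP.
    exact: measurable_normal_pdf.
  - by move=> x _; rewrite -EFinM lee_fin mulr_ge0// normal_pdf_ge0.
rewrite ge0_integralZl//.
- by rewrite integral_normal_pdf mule1.
- by apply/measurable_EFinP; exact: measurable_normal_pdf.
- by move=> x _; rewrite lee_fin normal_pdf_ge0.
Qed.

End gaussian_tail.

Section linear_kernel.
Context {R : realType}.
Context d1 (T1 : measurableType d1) (p q : nat).
Variables (mu : probability 'cV[R]_q R) (A : {mfun T1 >-> 'M[R]_(p, q)}).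
Local Open Scope ereal_scope.

Definition linear_image (M : 'M[R]_(p, q)) (e : 'cV[R]_q) : 'cV[R]_p := M *m e.

Lemma measurable_linear_image M : measurable_fun setT (linear_image M).
Proof. by apply: measurable_mxM => //; exact: measurable_cst. Qed.

HB.instance Definition _ M := @isMeasurableFun.Build _ _ 'cV[R]_q 'cV[R]_p
  (linear_image M) (measurable_linear_image M).

Lemma measurable_linear_image_pair :
  measurable_fun setT (fun xe : T1 * 'cV[R]_q => linear_image (A xe.1) xe.2).
Proof.
apply: measurable_mxM; last exact: measurable_snd.
exact: (measurableT_comp (measurable_funPT A) measurable_fst).
Qed.

Definition linear_law (x : T1) : {measure set 'cV[R]_p -> \bar R} :=
  distribution mu (linear_image (A x)).

Lemma measurable_linear_law (U : set 'cV[R]_p) : measurable U ->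
  measurable_fun setT (linear_law ^~ U).
Proof.
move=> mU; pose E := (fun xe : T1 * 'cV[R]_q => linear_image (A xe.1) xe.2) @^-1` U.
have mE : measurable E.
  rewrite -[X in measurable X]setTI; exact: measurable_linear_image_pair.
rewrite (_ : linear_law ^~ U = fun x => mu (xsection E x)).
  exact: measurable_fun_xsection.
apply/funext => x; congr (mu _); apply/seteqP; split => e /=.
  by rewrite /xsection /= inE.
by rewrite /xsection /= inE.
Qed.

HB.instance Definition _ :=
  @isKernel.Build _ _ _ _ R linear_law measurable_linear_law.

Lemma linear_law_setT x : linear_law x setT = 1.
Proof. exact: probability_setT. Qed.

HB.instance Definition _ :=
  @Kernel_isProbability.Build _ _ _ _ R linear_law linear_law_setT.

Definition linear_kernel : R.-pker T1 ~> 'cV[R]_p := linear_law.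

End linear_kernel.

Section conditional_law.
Context {R : realType} d (T : measurableType d) (P : probability T R).
Context d1 (T1 : measurableType d1) (p q : nat).
Variables (Y : {RV P >-> T1}) (eps : {RV P >-> 'cV[R]_q}).
Hypothesis ind : independent_rv P Y eps.
Local Open Scope ereal_scope.

(** Freezing the independent variable [Y] turns the law of [A Y *m eps] into
    that of a fixed linear image of [eps]. *)
Lemma linear_cond_distribution (A : {mfun T1 >-> 'M[R]_(p, q)}) :
  cond_distribution P Y (fun w => A (Y w) *m eps w)
    (linear_kernel (distribution P eps) A).
Proof.
move=> C B mC mB.
pose E := [set xe : T1 * 'cV[R]_q | C xe.1 /\ B (linear_image (A xe.1) xe.2)].
have mE : measurable E.
  rewrite (_ : E = (fst @^-1` C) `&`
    ((fun xe : T1 * 'cV[R]_q => linear_image (A xe.1) xe.2) @^-1` B))//.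
  apply: measurableI; rewrite -[X in measurable X]setTI.
    exact: measurable_fst.
  exact: measurable_linear_image_pair.
transitivity (P [set w | E (Y w, eps w)]); first by [].
rewrite (independent_joint_law ind)// [RHS]integral_mkcond.
apply: eq_integral => w _; rewrite /patch; case: ifPn.
  rewrite inE /= => CY; congr (distribution P eps _).
  by apply/seteqP; split => e /=; rewrite /xsection /= inE /E /= => // -[].
rewrite notin_setE /= => CY.
rewrite (_ : xsection E (Y w) = set0) ?measure0//.
by apply/seteqP; split => e //=; rewrite /xsection /= inE => -[].
Qed.

Lemma linear_cond_mvnormal (A : {mfun T1 >-> 'M[R]_(p, q)}) (s : R)
    (V : T1 -> 'M[R]_p) :
  is_mvnormal (distribution P eps) s%:M ->
  (forall x, V x = s *: (A x *m (A x)^T)) ->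
  cond_mvnormal P Y (fun w => A (Y w) *m eps w) V.
Proof.
move=> heps hV; exists (linear_kernel (distribution P eps) A).
split; last exact: linear_cond_distribution.
move=> x u B mB.
have := heps ((A x)^T *m u) B mB.
have -> : (((A x)^T *m u)^T *m s%:M *m ((A x)^T *m u)) 0%R 0%R =
          (u^T *m V x *m u) 0%R 0%R.
  by rewrite hV trmx_mul trmxK mul_mx_scalar -!scalemxAl -scalemxAr -scalemxAl !mulmxA.
move=> <-; congr (distribution P eps _).
by apply/seteqP; split => e /=; rewrite trmx_mul trmxK /linear_image !mulmxA.
Qed.

End conditional_law.

Section noise.
Context {R : realType} d (T : measurableType d) (P : probability T R).
Context (N n : nat).
Variables (X : {RV P >-> 'M[R]_(N, n)}) (eps : {RV P >-> 'cV[R]_N}).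
Hypothesis ind : independent_rv P X eps.
Local Open Scope ereal_scope.

(** Given [X], the [j]-th entry of the noise is a centred Gaussian variable of
    variance [sigma^2 S_jj / N], so its tail is integrated over the designs with
    [S_jj <= D]. *)
Lemma noise_tail (sigma D t : R) (j : 'I_n) :
  is_mvnormal (distribution P eps) (sigma ^+ 2)%:M ->
  (0 < N)%N -> (0 < sigma)%R -> (0 < D)%R -> (0 <= t)%R ->
  P [set w | sample_cov (X w) j j <= D /\
             sigma * t < `|(N%:R^-1 *: ((X w)^T *m eps w)) j ord0| ]%R <=
  (2 * expR (- (N%:R * t ^+ 2 / (4 * D))))%:E.
Proof.
move=> heps N0 s0 D0 t0; have NR0 : (0 < N%:R :> R)%R by rewrite ltr0n.
pose noise (x : 'M[R]_(N, n)) (e : 'cV[R]_N) : R :=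
  (N%:R^-1 *: (x^T *m e)) j ord0.
pose E := [set xe : 'M[R]_(N, n) * 'cV[R]_N | sample_cov xe.1 j j <= D /\
   sigma * t < `|noise xe.1 xe.2|]%R.
have mE : measurable E.
  rewrite (_ : E = [set xe | sample_cov xe.1 j j <= D]%R `&`
    [set xe | sigma * t < `|noise xe.1 xe.2|]%R)//.
  apply: measurableI.
    rewrite -[X in measurable X]setTI; apply: measurable_fun_le => //.
    apply: measurable_mx_entry; apply: measurable_mxZ; apply: measurable_mxM.
      by apply: measurable_mxT; exact: measurable_fst.
    exact: measurable_fst.
  apply: measurable_lt_set => //; apply: measurableT_comp => //.
  apply: measurable_mx_entry; apply: measurable_mxZ; apply: measurable_mxM.
    by apply: measurable_mxT; exact: measurable_fst.
  exact: measurable_snd.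
rewrite (_ : [set w | _] = [set w | E (X w, eps w)])//.
rewrite (independent_joint_law ind)//.
set c := (2 * expR _)%R.
have c0 : (0 <= c)%R by rewrite mulr_ge0 ?expR_ge0.
apply: (@le_trans _ _ (\int[P]_w c%:E)); last first.
  by rewrite integral_cst// -[leRHS]mule1 lee_wpmul2l ?lee_fin// probability_le1.
apply: ge0_le_integral => //.
  have mx := measurable_fun_xsection (distribution P eps) mE.
  exact: (measurableT_comp mx (measurable_funPT X)).
move=> w _; have [hD|hD] := leP (sample_cov (X w) j j) D; last first.
  rewrite (_ : xsection E (X w) = set0) ?measure0 ?lee_fin//.
  apply/seteqP; split => e //=; rewrite /xsection /= inE => -[/=].
  by rewrite leNgt hD.
rewrite (_ : xsection E (X w) =
  [set e | [set z | sigma * t < `|z|]%R (((N%:R^-1 *: col j (X w))^T *m e) ord0 ord0)]); last first.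
  have nE e : noise (X w) e = ((N%:R^-1 *: col j (X w))^T *m e) ord0 ord0.
    rewrite /noise linearZ/= -scalemxAl !mxE; congr (_ * _)%R.
    by apply: eq_bigr => i _; rewrite !mxE.
  apply/seteqP; split => e /=; rewrite /xsection /= inE /E /= nE => //.
  by case.
have mA : measurable [set z : R | sigma * t < `|z|]%R.
  by apply: measurable_lt_set => //; exact: measurableT_comp.
rewrite heps//.
have -> : ((N%:R^-1 *: col j (X w))^T *m (sigma ^+ 2)%:M *m
    (N%:R^-1 *: col j (X w))) ord0 ord0 =
    (sigma ^+ 2 * (N%:R^-1 * sample_cov (X w) j j))%R.
  have -> : (N%:R^-1 *: col j (X w))^T = N%:R^-1 *: (col j (X w))^T :> 'rV[R]_N.
    by rewrite linearZ.
  rewrite mul_mx_scalar -!scalemxAl -scalemxAr !mxE.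
  congr (_ * (_ * (_ * _)))%R.
  by apply: eq_bigr => i _; rewrite !mxE.
apply: (le_trans (@normal_law_tail _ _ (sigma ^+ 2 * (N%:R^-1 * D)) _ _ _ _)).
- apply/andP; split.
    apply: mulr_ge0; first exact: sqr_ge0.
    apply: mulr_ge0; first by rewrite invr_ge0.
    rewrite /sample_cov !mxE mulr_ge0 ?invr_ge0// sumr_ge0// => i _.
    by rewrite mxE -expr2 sqr_ge0.
  by rewrite ler_wpM2l ?sqr_ge0// ler_wpM2l// invr_ge0.
- by rewrite !mulr_gt0 ?exprn_gt0 ?invr_gt0.
- by rewrite mulr_ge0// ltW.
rewrite lee_fin /c ler_wpM2l// ler_expR lerN2 exprMn.
rewrite le_eqVlt; apply/orP; left; apply/eqP; field.
by rewrite !gt_eqF.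
Qed.

End noise.

(** * The good event *)

Section constants.
Context {R : realType} (sigma_x c : R).
Hypotheses (sx0 : 0 < sigma_x) (c0 : 0 < c).

(** A bound for the euclidean norm of unit vectors and of the rows of the
    precision matrix. *)
Definition row_radius : R := 1 + c^-1.

(** The absolute products of two row functionals with directions in the ball of
    radius [row_radius] have an exponential moment of this order. *)
Definition mgf_order : R := (2 * expR 1 * (sigma_x * row_radius) ^+ 2)^-1.

(** The deviation of the sample covariance form that is tolerated in a fixed
    direction: half of the coercivity constant suffices, and the second term
    keeps the deviation in the Gaussian regime of the tail bound. *)
Definition cov_deviation : R := Num.min (c / 2) (64 / mgf_order).

(** Exponential rates of the failure probabilities: per sample for deviations of
    size [cov_deviation], and per squared unit of the deviation for those that
    shrink with the sample size. *)
Definition sparse_rate : R := cov_deviation ^+ 2 * mgf_order ^+ 2 / 256.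
Definition diag_bound : R := 4 / mgf_order + cov_deviation.
Definition entry_rate : R := Num.min (mgf_order ^+ 2 / 256) (4 * diag_bound)^-1.

Lemma row_radius_gt0 : 0 < row_radius.
Proof. by rewrite addr_gt0// invr_gt0. Qed.

Lemma mgf_order_gt0 : 0 < mgf_order.
Proof.
by rewrite invr_gt0 !mulr_gt0 ?expR_gt0 ?exprn_gt0 ?mulr_gt0 ?row_radius_gt0.
Qed.

Lemma cov_deviation_gt0 : 0 < cov_deviation.
Proof. by rewrite /cov_deviation lt_min !divr_gt0// mgf_order_gt0. Qed.

Lemma diag_bound_gt0 : 0 < diag_bound.
Proof. by rewrite /diag_bound addr_gt0 ?cov_deviation_gt0// divr_gt0// mgf_order_gt0. Qed.

Lemma sparse_rate_gt0 : 0 < sparse_rate.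
Proof. by rewrite /sparse_rate divr_gt0// mulr_gt0// exprn_gt0 ?cov_deviation_gt0 ?mgf_order_gt0. Qed.

Lemma entry_rate_gt0 : 0 < entry_rate.
Proof.
rewrite /entry_rate lt_min; apply/andP; split.
  by rewrite divr_gt0// exprn_gt0// mgf_order_gt0.
by rewrite invr_gt0 mulr_gt0// diag_bound_gt0.
Qed.

End constants.

Section finite_union.
Context {R : realType} d (T : measurableType d) (P : probability T R).
Local Open Scope ereal_scope.

Lemma finite_union_bound (I : finType) (A : I -> set T) (b : R) :
  (forall i, measurable (A i)) -> (forall i, P (A i) <= b%:E) ->
  measurable [set w | exists i, A i w] /\
  P [set w | exists i, A i w] <= (#|I|%:R * b)%:E.
Proof.
move=> mA Ab.
suff H : forall s : seq I, measurable [set w | exists2 i, i \in s & A i w] /\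
    P [set w | exists2 i, i \in s & A i w] <= ((size s)%:R * b)%:E.
  have := H (enum I); rewrite -cardE.
  rewrite (_ : [set w | exists2 i, _ & _] = [set w | exists i, A i w])//.
  apply/seteqP; split => w /=; first by move=> [i _ h]; exists i.
  by move=> [i h]; exists i; rewrite ?mem_enum.
elim=> [|i s [ms IH]].
  rewrite (_ : [set w | _] = set0); last by apply/seteqP; split => w // [].
  by rewrite measure0 mul0r; split.
rewrite (_ : [set w | _] = A i `|` [set w | exists2 i, i \in s & A i w]); last first.
  apply/seteqP; split => w /=.
    by move=> [k]; rewrite inE => /orP[/eqP ->|ks] h; [left|right; exists k].
  move=> [h|[k ks h]]; first by exists i; rewrite ?mem_head.
  by exists k; rewrite ?inE ?ks ?orbT.
split; first exact: measurableU.
apply: (le_trans (measureU2 _ (mA i) ms)).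
by rewrite /= -natr1 mulrDl mul1r addrC EFinD leeD.
Qed.

End finite_union.

Section good_event.
Context {R : realType} d (T : measurableType d) (P : probability T R).
Context (N n : nat) (X : {RV P >-> 'M[R]_(N, n)}) (eps : {RV P >-> 'cV[R]_N}).
Context (Sigma : 'M[R]_n) (sigma_x sigma_eps c : R).
Hypotheses (N0 : (0 < N)%N) (n1 : (1 < n)%N).
Hypotheses (sx0 : (0 < sigma_x)) (se0 : (0 < sigma_eps)) (c0 : (0 < c)).
Hypothesis hX : rowwise_subgaussian P sigma_x Sigma X.
Hypothesis heig : forall x : R, eigenvalue Sigma x -> (c <= x).
Hypothesis heps : is_mvnormal (distribution P eps) (sigma_eps ^+ 2)%:M.
Hypothesis hind : independent_rv P X eps.

Local Notation rho := (row_radius c).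
Local Notation theta := (mgf_order sigma_x c).
Local Notation t1 := (cov_deviation sigma_x c).
Local Notation D0 := (diag_bound sigma_x c).
Local Notation kappa := (sparse_rate sigma_x c).
Local Notation kappa3 := (entry_rate sigma_x c).

Let i0 : 'I_N := Ordinal N0.

Let t1_theta : t1 * theta <= 64.
Proof.
by rewrite -ler_pdivlMr ?mgf_order_gt0// /cov_deviation ge_min lexx orbT.
Qed.

Lemma covariance_symmetric : Sigma^T = Sigma.
Proof.
have [_ _ _ hcov] := hX; apply/matrixP => j j'; rewrite mxE.
by have := hcov i0 j j'; rewrite covarianceC hcov => -[].
Qed.

Lemma covariance_coercive u : (c * sqnorm2 u <= dot u (Sigma *m u)).
Proof.
by apply: eigenvalue_rayleigh; [exact: covariance_symmetric|exact: ltnW|].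
Qed.

Lemma covariance_unitmx : Sigma \in unitmx.
Proof.
apply: contraT => h; have /eigenvalue_notin_unitmx/heig : Sigma - 0%:M \notin unitmx.
  by rewrite raddf0 subr0.
by rewrite leNgt c0.
Qed.

Lemma precision_symmetric : (invmx Sigma)^T = invmx Sigma.
Proof. by rewrite trmx_inv covariance_symmetric. Qed.

(** With [v] the image of [u], coercivity gives [c |v|^2 <= v'u], and expanding
    [|c v - u|^2 >= 0] eliminates the product [v'u]. *)
Lemma precision_bound u : (sqnorm2 (invmx Sigma *m u) <= c^-1 ^+ 2 * sqnorm2 u).
Proof.
set v := invmx Sigma *m u.
have Sv : Sigma *m v = u by rewrite mulmxA mulmxV ?mul1mx// covariance_unitmx.
have := covariance_coercive v; rewrite Sv.
have := sqnorm2_ge0 (c *: v - u); rewrite sqnorm2B sqnorm2Z dotZl => h1 h2.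
have : (c * (c * sqnorm2 v) <= c * dot v u) by rewrite ler_pM2l.
rewrite exprVn ler_pdivlMl ?exprn_gt0//; rewrite expr2 in h1 *; lra.
Qed.

(** A variance is dominated by an exponential moment, through [x <= exp x]. *)
Lemma covariance_diag_le j : (Sigma j j <= 4 / theta).
Proof.
have hd : (sqnorm2 (delta_mx j 0 : 'cV[R]_n) <= rho ^+ 2).
  rewrite sqnorm2_delta -[X in (X <= _)](expr1n _ 2) ler_sqr ?nnegrE ?(ltW (row_radius_gt0 c0))//.
  by rewrite lerDl invr_ge0 ltW.
have := row_product_mgf sx0 hX (row_radius_gt0 c0) hd hd i0.
have := row_product_mean sx0 hX i0 (delta_mx j 0) (delta_mx j 0).
rewrite dot_delta mulmx_delta -/theta => hm hg.
rewrite ler_pdivlMr ?mgf_order_gt0// mulrC -lee_fin EFinM -hm.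
set f := row_functional X i0 (delta_mx j 0).
have mf : measurable_fun setT f by exact: measurable_row_functional.
have mff : measurable_fun setT (fun w => (f w * f w)%:E).
  by apply/measurable_EFinP; exact: measurable_funM.
have ff0 w : (0 <= (f w * f w)%:E)%E by rewrite lee_fin -expr2 sqr_ge0.
rewrite -ge0_integralZl ?lee_fin ?(ltW (mgf_order_gt0 _ _))//.
apply: (le_trans _ hg).
apply: ge0_le_integral => //.
- by move=> w _; rewrite mule_ge0// lee_fin ltW// mgf_order_gt0.
- exact: emeasurable_funM.
- apply/measurable_EFinP; apply: measurableT_comp => //.
  apply: measurable_funM => //; apply: measurableT_comp => //.
  exact: measurable_funM.
- move=> w _; rewrite -EFinM lee_fin.
  apply: (@le_trans _ _ (theta * `|f w * f w|)).
    by rewrite ler_wpM2l ?ler_norm// ltW// mgf_order_gt0.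
  by rewrite (le_trans _ (expR_ge1Dx _))// lerDr.
Qed.

(** After normalising the direction, this is the lower tail of the sample
    covariance form, obtained from the upper tail by changing one sign. *)
Lemma signed_sum_tail q (t : q.-tuple ('I_n * bool)) :
  measurable [set w | dot (signed_sum t) (sample_cov (X w) *m signed_sum t)
                      < c / 2 * sqnorm2 (signed_sum t)] /\
  (P [set w | (dot (signed_sum t) (sample_cov (X w) *m signed_sum t)
             < c / 2 * sqnorm2 (signed_sum t))%R] <= (expR (- (N%:R * kappa)))%:E)%E.
Proof.
set y := signed_sum t; set A := [set w | _].
have mS : measurable_fun setT (fun w => dot y (sample_cov (X w) *m y)).
  apply: measurable_dot => //; apply: measurable_mxM => //.
  by apply: measurable_mxZ; apply: measurable_mxM => //; exact: measurable_mxT.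
have mA : measurable A by exact: measurable_lt_set.
split => //; have [y0|y0] := eqVneq y 0.
  rewrite (_ : A = set0) ?measure0 ?lee_fin ?expR_ge0//.
  by apply/seteqP; split => w //; rewrite /A /= y0 sqnorm2E !dot0l mulr0 ltxx.
have yp : 0 < sqnorm2 y.
  by rewrite lt_def sqnorm2_ge0 andbT; apply: contra_neq y0 => /sqnorm2_eq0.
pose q' := Num.sqrt (sqnorm2 y).
have qp : 0 < q' by rewrite sqrtr_gt0.
have qq : q' ^+ 2 = sqnorm2 y by rewrite sqr_sqrtr// ltW.
have hz (z : 'cV[R]_n) : sqnorm2 z = 1 -> sqnorm2 z <= rho ^+ 2.
  move=> ->; rewrite -[X in X <= _](expr1n _ 2) ler_sqr ?nnegrE ?(ltW (row_radius_gt0 c0))//.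
  by rewrite lerDl invr_ge0 ltW.
have nv : sqnorm2 (q'^-1 *: y) = 1.
  by rewrite sqnorm2Z exprVn qq mulVf// gt_eqF.
have nu : sqnorm2 (- (q'^-1 *: y)) = 1.
  by rewrite -scaleN1r sqnorm2Z sqrrN expr1n mul1r.
have := sample_cov_tail sx0 hX (row_radius_gt0 c0) (hz _ nu) (hz _ nv) N0 (cov_deviation_gt0 sx0 c0).
move=> /(_ t1_theta); apply: le_trans.
apply: le_measure; rewrite ?inE//.
  rewrite -[X in measurable X]setTI; apply: measurable_fun_le => //.
  apply: measurable_funB => //; apply: measurable_dot => //.
  apply: measurable_mxM => //.
  by apply: measurable_mxZ; apply: measurable_mxM => //; exact: measurable_mxT.
move=> w; rewrite /A /= => h.
rewrite -!scalemxAr !dotNl !dotZl !dotZr.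
have hc := covariance_coercive y.
have -> : - (q'^-1 * (q'^-1 * dot y (sample_cov (X w) *m y))) -
     - (q'^-1 * (q'^-1 * dot y (Sigma *m y))) =
     (dot y (Sigma *m y) - dot y (sample_cov (X w) *m y)) / sqnorm2 y.
  by rewrite -qq; field; rewrite gt_eqF.
rewrite ler_pdivlMr// (@le_trans _ _ (c / 2 * sqnorm2 y))//.
  by rewrite ler_pM2r// /cov_deviation ge_min lexx.
lra.
Qed.

Lemma diag_tail j :
  measurable [set w | D0 < sample_cov (X w) j j] /\
  (P [set w | (D0 < sample_cov (X w) j j)%R] <= (expR (- (N%:R * kappa)))%:E)%E.
Proof.
set A := [set w | _].
have mS : measurable_fun setT (fun w => sample_cov (X w) j j).
  apply: measurable_mx_entry; apply: measurable_mxZ.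
  by apply: measurable_mxM => //; exact: measurable_mxT.
have mA : measurable A by exact: measurable_lt_set.
split => //.
have hd : sqnorm2 (delta_mx j 0 : 'cV[R]_n) <= rho ^+ 2.
  rewrite sqnorm2_delta -[X in (X <= _)](expr1n _ 2) ler_sqr ?nnegrE ?(ltW (row_radius_gt0 c0))//.
  by rewrite lerDl invr_ge0 ltW.
have := sample_cov_tail sx0 hX (row_radius_gt0 c0) hd hd N0 (cov_deviation_gt0 sx0 c0).
move=> /(_ t1_theta); apply: le_trans.
apply: le_measure; rewrite ?inE//.
  rewrite -[X in measurable X]setTI; apply: measurable_fun_le => //.
  apply: measurable_funB => //; apply: measurable_dot => //.
  apply: measurable_mxM => //.
  by apply: measurable_mxZ; apply: measurable_mxM => //; exact: measurable_mxT.
move=> w; rewrite /A /= !dot_delta !mulmx_delta => h.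
by have := covariance_diag_le j; rewrite /diag_bound in h; lra.
Qed.

(** The entry is the deviation of the covariance form at a row of the precision
    matrix and a basis vector; each sign gives one of the two tails. *)
Lemma precision_tail x i j : 0 < x -> x * theta <= 64 ->
  measurable [set w | x < `|(invmx Sigma *m sample_cov (X w) - 1%:M) i j| ] /\
  (P [set w | (x < `|(invmx Sigma *m sample_cov (X w) - 1%:M) i j|)%R] <=
   (2 * expR (- (N%:R * (x ^+ 2 * theta ^+ 2 / 256))))%:E)%E.
Proof.
move=> x0 xt; set A := [set w | _].
have mS : measurable_fun setT (fun w => sample_cov (X w)).
  by apply: measurable_mxZ; apply: measurable_mxM => //; exact: measurable_mxT.
have mA : measurable A.
  apply: measurable_lt_set => //; apply: measurableT_comp => //.
  apply: measurable_mx_entry; apply: measurable_mxB => //.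
  by apply: measurable_mxM => //; exact: measurable_cst.
split => //.
pose v : 'cV[R]_n := delta_mx j 0.
have entry w (s : R) : dot (s *: (invmx Sigma *m delta_mx i 0)) (sample_cov (X w) *m v)
    - dot (s *: (invmx Sigma *m delta_mx i 0)) (Sigma *m v) =
    s * (invmx Sigma *m sample_cov (X w) - 1%:M) i j.
  rewrite !dotZl -mulrBr -dotBr -{1}precision_symmetric -dot_mulmx dot_delta.
  rewrite mulmxBr !mulmxA mulVmx ?covariance_unitmx// -mulmxBl.
  by rewrite mulmx_delta.
have hv : sqnorm2 v <= rho ^+ 2.
  rewrite sqnorm2_delta -[X in (X <= _)](expr1n _ 2) ler_sqr ?nnegrE ?(ltW (row_radius_gt0 c0))//.
  by rewrite lerDl invr_ge0 ltW.
have hu s : s ^+ 2 = 1 -> sqnorm2 (s *: (invmx Sigma *m delta_mx i 0)) <= rho ^+ 2.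
  move=> s1; rewrite sqnorm2Z s1 mul1r (le_trans (precision_bound _))//.
  rewrite sqnorm2_delta mulr1 ler_sqr ?nnegrE ?(ltW (row_radius_gt0 c0)) ?invr_ge0 ?(ltW c0)//.
  by rewrite lerDr.
pose B (s : R) := [set w | x <= dot (s *: (invmx Sigma *m delta_mx i 0))
   (sample_cov (X w) *m v) - dot (s *: (invmx Sigma *m delta_mx i 0)) (Sigma *m v)].
have mB s : measurable (B s).
  rewrite -[X in measurable X]setTI; apply: measurable_fun_le => //.
  apply: measurable_funB => //; apply: measurable_dot => //.
  exact: measurable_mxM.
have tB s : s ^+ 2 = 1 ->
    (P (B s) <= (expR (- (N%:R * (x ^+ 2 * theta ^+ 2 / 256))))%:E)%E.
  by move=> s1; exact: (sample_cov_tail sx0 hX (row_radius_gt0 c0) (hu _ s1) hv N0 x0).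
apply: (@le_trans _ _ (P (B 1 `|` B (-1)))).
  apply: le_measure; rewrite ?inE//; first exact: measurableU.
  move=> w; rewrite /A /B /= !entry mul1r mulN1r => h.
  have [e0|e0] := leP 0 ((invmx Sigma *m sample_cov (X w) - 1%:M) i j).
    by left; rewrite ger0_norm// in h; exact: ltW.
  by right; rewrite ltr0_norm// in h; exact: ltW.
apply: (le_trans (measureU2 _ (mB _) (mB _))).
rewrite mulr_natl mulr2n EFinD; apply: leeD; apply: tB.
  by rewrite expr1n.
by rewrite sqrrN expr1n.
Qed.

(** The noise is only controlled where the diagonal of the sample covariance
    matrix, hence the conditional variance, is. *)
Lemma noise_event_tail x j : 0 < x ->
  measurable [set w | sample_cov (X w) j j <= D0 /\
    sigma_eps * x < `|(N%:R^-1 *: ((X w)^T *m eps w)) j 0|] /\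
  (P [set w | (sample_cov (X w) j j <= D0 /\
    sigma_eps * x < `|(N%:R^-1 *: ((X w)^T *m eps w)) j 0|)%R] <=
   (2 * expR (- (N%:R * x ^+ 2 / (4 * D0))))%:E)%E.
Proof.
move=> x0; split; last by apply: noise_tail => //; [exact: diag_bound_gt0|exact: ltW].
have mXT : measurable_fun setT (fun w => (X w)^T) by exact: measurable_mxT.
rewrite [X in measurable X](_ : _ = [set w | sample_cov (X w) j j <= D0] `&`
  [set w | sigma_eps * x < `|(N%:R^-1 *: ((X w)^T *m eps w)) j 0|])//.
apply: measurableI.
  rewrite -[X in measurable X]setTI; apply: measurable_fun_le => //.
  by apply: measurable_mx_entry; apply: measurable_mxZ; exact: measurable_mxM.
apply: measurable_lt_set => //; apply: measurableT_comp => //.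
by apply: measurable_mx_entry; apply: measurable_mxZ; exact: measurable_mxM.
Qed.

(** The signed sums give the restricted eigenvalue condition, the diagonal bound
    makes the transfer and the noise bound effective, and the two entrywise bounds
    serve the CLIME matrix and the lasso. *)
Definition good_event q (x : R) (w : T) : Prop :=
  [/\ forall t : q.-tuple ('I_n * bool), c / 2 * sqnorm2 (signed_sum t) <=
         dot (signed_sum t) (sample_cov (X w) *m signed_sum t),
      forall j, sample_cov (X w) j j <= D0,
      forall i j, `|(invmx Sigma *m sample_cov (X w) - 1%:M) i j| <= x &
      forall j, `|(N%:R^-1 *: ((X w)^T *m eps w)) j 0| <= sigma_eps * x].

(** A union bound: [(2 n)^q] signed sums and [n] diagonal entries fail at an
    exponential rate in [N], while the [n^2] entries of the precision residual and
    the [n] noise entries fail at a polynomial rate in [n]. *)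
Lemma good_event_probability q (tau r : R) :
  0 < tau * r -> tau * r * theta <= 64 -> N%:R * r ^+ 2 = ln n%:R ->
  measurable (~` [set w | good_event q (tau * r) w]) /\
  (P (~` [set w | good_event q (tau * r) w]) <=
   ((2 * n%:R) ^+ q.+1 * expR (- (N%:R * kappa))
    + 4 * n%:R ^+ 2 * expR (- (kappa3 * tau ^+ 2 * ln n%:R)))%:E)%E.
Proof.
move=> x0 xt rn; set x := tau * r.
have [m1 p1] := finite_union_bound
  (fun t : q.-tuple ('I_n * bool) => (signed_sum_tail t).1)
  (fun t => (signed_sum_tail t).2).
have [m2 p2] := finite_union_bound
  (fun j => (diag_tail j).1) (fun j => (diag_tail j).2).
have [m3 p3] := finite_union_bound
  (fun ij : 'I_n * 'I_n => (precision_tail ij.1 ij.2 x0 xt).1)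
  (fun ij => (precision_tail ij.1 ij.2 x0 xt).2).
have [m4 p4] := finite_union_bound
  (fun j => (noise_event_tail j x0).1) (fun j => (noise_event_tail j x0).2).
move: m1 p1 m2 p2 m3 p3 m4 p4.
set U1 := [set w | _]; set U2 := [set w | _]; set U3 := [set w | _].
set U4 := [set w | _] => m1 p1 m2 p2 m3 p3 m4 p4.
have -> : ~` [set w | good_event q x w] = U1 `|` U2 `|` (U3 `|` U4).
  apply/seteqP; split => w /=.
    apply: contra_notP => /not_orP[/not_orP[h1 h2] /not_orP[h3 h4]].
    have hd j : sample_cov (X w) j j <= D0.
      by rewrite leNgt; apply/negP => h; apply: h2; exists j.
    split=> //.
    - by move=> t; rewrite leNgt; apply/negP => h; apply: h1; exists t.
    - by move=> i j; rewrite leNgt; apply/negP => h; apply: h3; exists (i, j).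
    - by move=> j; rewrite leNgt; apply/negP => h; apply: h4; exists j.
  move=> h [g1 g2 g3 g4].
  case: h => [[[t]|[j]]|[[ij]|[j [_]]]] /=; rewrite ltNge => /negP; apply.
  - exact: g1.
  - exact: g2.
  - exact: g3.
  - exact: g4.
have mU : measurable (U1 `|` U2 `|` (U3 `|` U4)).
  by apply: measurableU; exact: measurableU.
split => //.
apply: (le_trans (measureU2 _ (measurableU _ _ m1 m2) (measurableU _ _ m3 m4))).
have n0 : 1 <= n%:R :> R by rewrite ler1n ltnW.
have ln0 : 0 <= ln n%:R :> R by rewrite ln_ge0.
rewrite EFinD; apply: leeD.
  apply: (le_trans (measureU2 _ m1 m2)).
  apply: (le_trans (leeD p1 p2)); rewrite -EFinD lee_fin -mulrDl.
  rewrite ler_wpM2r ?expR_ge0// card_tuple card_prod card_ord card_bool.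
  rewrite natrX natrM (mulrC n%:R) exprS.
  have : 1 <= (2 * n%:R) ^+ q :> R by rewrite exprn_ege1//; lra.
  move: ((2 * n%:R) ^+ q : R) => A hA; nra.
apply: (le_trans (measureU2 _ m3 m4)).
apply: (le_trans (leeD p3 p4)); rewrite -EFinD lee_fin.
set E := expR (- (kappa3 * _ * _)).
have hE y : kappa3 <= y -> expR (- (N%:R * x ^+ 2 * y)) <= E.
  move=> hy; rewrite ler_expR lerN2.
  have -> : N%:R * x ^+ 2 * y = tau ^+ 2 * ln n%:R * y by rewrite -rn /x; ring.
  have -> : kappa3 * tau ^+ 2 * ln n%:R = tau ^+ 2 * ln n%:R * kappa3 by ring.
  by rewrite ler_wpM2l// mulr_ge0// sqr_ge0.
have e3 : expR (- (N%:R * (x ^+ 2 * theta ^+ 2 / 256))) <= E.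
  rewrite (_ : N%:R * _ = N%:R * x ^+ 2 * (theta ^+ 2 / 256)); last by ring.
  by apply: hE; rewrite /entry_rate ge_min lexx.
have e4 : expR (- (N%:R * x ^+ 2 / (4 * D0))) <= E.
  by apply: hE; rewrite /entry_rate ge_min lexx orbT.
rewrite card_prod !card_ord natrM.
have E0 : 0 <= E by exact: expR_ge0.
have : n%:R * n%:R * (2 * expR (- (N%:R * (x ^+ 2 * theta ^+ 2 / 256)))) <=
       n%:R * n%:R * (2 * E).
  by rewrite !ler_wpM2l// mulr_ge0.
have : n%:R * (2 * expR (- (N%:R * x ^+ 2 / (4 * D0)))) <= n%:R * (2 * E).
  by rewrite !ler_wpM2l.
have : n%:R * (2 * E) <= n%:R * n%:R * (2 * E).
  by rewrite ler_wpM2r ?mulr_ge0// ler_peMl.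
by rewrite expr2; lra.
Qed.

End good_event.

(** * Deterministic bounds on the good event *)

Section bounds_on_good_event.
Context {R : realType} {n N : nat} (G : sgraph n) (k s1 s2 q : nat).
Context (nu sigma c D a b tau r L H M : R).
Context (X : 'M[R]_(N, n)) (e : 'cV[R]_N) (beta bh : 'cV[R]_n).
Context (Th T0 : 'M[R]_n).
Let lam := a * (sigma * r).
Let S := sample_cov X.
Hypotheses (N0 : (0 < N)%N) (q0 : (0 < q)%N) (s10 : (0 < s1)%N).
Hypotheses (D0 : 0 <= D) (a0 : 0 < a) (b0 : 0 < b) (c0 : 0 < c).
Hypotheses (sigma0 : 0 < sigma) (r0 : 0 < r) (tau0 : 0 < tau) (nu0 : 0 <= nu).
Hypothesis hs : nu <= s2%:R / s1%:R.
Hypothesis hbeta : param_space G k s1 s2 beta.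
Hypothesis hlasso : is_gpp_lasso G k lam
  (lam * Num.sqrt (nu / (2 * (max_degree G)%:R) ^+ k.+1)) X (X *m beta + e) bh.
Hypothesis hclime :
  (exists Th0, clime_feasible S (b * r) Th0) -> is_clime S (b * r) Th.
Hypotheses (T0T : T0^T = T0) (T0M : row_l1_le T0 M).
Hypothesis hre : forall t : q.-tuple ('I_n * bool),
  c / 2 * sqnorm2 (signed_sum t) <= dot (signed_sum t) (S *m signed_sum t).
Hypothesis hdiag : forall j, S j j <= D.
Hypothesis hprec : forall i j, `|(T0 *m S - 1%:M) i j| <= tau * r.
Hypothesis hnoise : forall j, `|(N%:R^-1 *: (X^T *m e)) j 0| <= sigma * (tau * r).
Hypothesis hq : D * L <= (q%:R - 1) * (c / 4).
Hypotheses (q1 : (1 < q)%N) (LH : L <= H * s2%:R) (H1 : 1 <= H).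
(* The first case is the classical regime, where the penalties dominate the
   noise level [tau]; the second one is that of a small dimension, where [tau]
   may be large because every l1 norm is comparable to the l2 norm. *)
Hypothesis halt : [/\ 2 * tau <= a, tau <= b & L = 36 * s2%:R] \/
  (n%:R <= L /\ n%:R * (tau * r) <= 1 / 2).

Let ST : S^T = S.
Proof. by rewrite /S /sample_cov linearZ/= trmx_mul trmxK. Qed.

Let lam0 : 0 < lam. Proof. by rewrite !mulr_gt0. Qed.

(** In both regimes the l1 norm of the error is controlled by its l2 norm at level
    [L], so the transfer principle with [q] large compared to [L] makes the sample
    covariance form coercive at the error. *)
Lemma lasso_error_on_good :
  norm1 (bh - beta) <= 8 / c * (tau + 2 * a) * (H * s2%:R) * (sigma * r).
Proof.
set D' := bh - beta.
have hL : norm1 D' ^+ 2 <= L * sqnorm2 D'.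
  case: halt => [[ta _ ->]|[nL _]].
    apply: (lasso_cone N0 lam0 s10 nu0 hs hbeta hlasso hnoise).
    rewrite /lam (_ : 2 * _ = 2 * tau * (sigma * r)); last by ring.
    by rewrite ler_wpM2r// mulr_ge0// ltW.
  by rewrite (le_trans (norm1_le_sqnorm2 _))// ler_wpM2r// sqnorm2_ge0.
have hk : c / 4 * sqnorm2 D' <= dot D' (S *m D').
  have c2 : 0 <= c / 2 by rewrite divr_ge0// ltW.
  have := restricted_eigenvalue ST c2 q0 hdiag hre D'.
  have qp : 0 < q%:R - 1 :> R by rewrite subr_gt0 ltr1n.
  have DL : D * norm1 D' ^+ 2 <= (q%:R - 1) * (c / 4) * sqnorm2 D'.
    apply: (@le_trans _ _ (D * (L * sqnorm2 D'))); first by rewrite ler_wpM2l.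
    by rewrite mulrA ler_wpM2r// sqnorm2_ge0.
  move=> /le_trans/(_ DL); rewrite -(mulrA _ (c / 4)) ler_pM2l//; lra.
have e0 : 0 <= sigma * (tau * r) by rewrite !mulr_ge0// ltW.
have k0 : 0 < c / 4 by rewrite divr_gt0.
have := lasso_l1_error N0 lam0 s10 nu0 hs hbeta hlasso hnoise k0 e0 H1 hL LH hk.
rewrite (_ : 2 / (c / 4) = 8 / c); last by field; rewrite gt_eqF.
rewrite (_ : sigma * (tau * r) + 2 * lam = (tau + 2 * a) * (sigma * r)); last first.
  by rewrite /lam; ring.
by move=> /le_trans; apply; rewrite le_eqVlt; apply/orP; left; apply/eqP; ring.
Qed.

(** A feasible matrix with short rows: the precision matrix itself if [mu] is
    large enough, and else the inverse of the sample covariance matrix. *)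
Lemma clime_on_good : clime_feasible S (b * r) Th /\ row_l1_le Th (2 * M).
Proof.
suff [Th0 f0 l0] : exists2 Th0, clime_feasible S (b * r) Th0 & row_l1_le Th0 (2 * M).
  have hc := hclime (ex_intro _ _ f0); split; first by case: hc.
  by move=> i; exact: le_trans (clime_row_l1 hc f0 i) (l0 i).
have br0 : 0 <= b * r by rewrite ltW// mulr_gt0.
case: halt => [[_ tb _]|[_ ntr]].
  exists T0.
    apply/(mx_norm_leP _ br0) => i j; rewrite (le_trans (hprec i j))//.
    by rewrite ler_wpM2r// ltW.
  move=> i; rewrite (le_trans (T0M i))//.
  have := le_trans (sumr_ge0 _ (fun j _ => normr_ge0 (T0 i j))) (T0M i).
  lra.
have tr0 : 0 <= tau * r by rewrite ltW// mulr_gt0.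
have [uS lS] := inverse_feasible tr0 ntr T0M hprec.
exists (invmx S) => //; rewrite /clime_feasible mulVmx// subrr mx_norm0//.
Qed.

(** Duality between the maximum norm of the CLIME residual and the l1 norm of the
    error of the lasso. *)
Lemma one_step_error_on_good i :
  `|((Th *m S - 1%:M) *m (bh - beta)) i 0| <=
  b * (8 / c * (tau + 2 * a) * H) * (sigma * s2%:R * r ^+ 2).
Proof.
have br0 : 0 <= b * r by rewrite ltW// mulr_gt0.
have [/(mx_norm_leP _ br0) f _] := clime_on_good.
have -> : ((Th *m S - 1%:M) *m (bh - beta)) i 0 =
    dot (row i (Th *m S - 1%:M))^T (bh - beta).
  rewrite mxE; apply: eq_bigr => j _.
  by rewrite [X in _ = X * _]mxE [X in _ = X * _]mxE.
apply: (le_trans (@ler_dot _ _ _ _ (b * r) _)).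
  by move=> j; rewrite 2!mxE.
apply: (le_trans (ler_wpM2l br0 lasso_error_on_good)).
by rewrite le_eqVlt; apply/orP; left; apply/eqP; ring.
Qed.

Lemma clime_error_on_good i j :
  `|(Th *m S *m Th^T - T0) i j| <= (3 * b + 2 * tau) * (M * r).
Proof.
have br0 : 0 <= b * r by rewrite ltW// mulr_gt0.
have tr0 : 0 <= tau * r by rewrite ltW// mulr_gt0.
have [f l] := clime_on_good.
apply: (le_trans (clime_covariance_error ST T0T br0 tr0 l T0M f hprec i j)).
by rewrite le_eqVlt; apply/orP; left; apply/eqP; ring.
Qed.

End bounds_on_good_event.

(** * Choice of the constants *)

Section rates.
Context {R : realType}.

Lemma expRN_le_inv (x : R) : 0 < x -> expR (- x) <= x^-1.
Proof.
move=> x0; rewrite expRN lef_pV2 ?posrE ?expR_gt0//.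
by rewrite (le_trans _ (expR_ge1Dx x))// lerDr.
Qed.

Lemma nat_above (x : R) : exists A : nat, x <= A%:R.
Proof.
exists (Num.trunc `|x|).+1; rewrite (le_trans (ler_norm x))//.
by rewrite ltW// truncnS_gt.
Qed.

Lemma rate_sq n N : (0 < N)%N -> (1 < n)%N ->
  N%:R * Num.sqrt (ln n%:R / N%:R) ^+ 2 = ln n%:R :> R.
Proof.
move=> N0 n1; have NR : 0 < N%:R :> R by rewrite ltr0n.
have l0 : 0 < ln n%:R :> R by rewrite ln_gt0// ltr1n.
by rewrite sqr_sqrtr ?divr_ge0 ?ltW// mulrC divfK// gt_eqF.
Qed.

Context (kappa kappa3 theta : R).
Hypotheses (k0 : 0 < kappa) (k30 : 0 < kappa3) (th0 : 0 < theta).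

(** With this value the [n^2] entrywise deviations fail with probability of order
    [n^2 exp (- 3 ln n) = 1 / n]. *)
Definition tau_large : R := Num.sqrt (3 / kappa3).

(** The first term pays for the union bound over signed sums of about [A s] terms,
    the second one keeps the entrywise deviations in the Gaussian regime. *)
Definition sample_constant (A : nat) : R :=
  4 * (A%:R + 2) / kappa + tau_large ^+ 2 * theta ^+ 2.

(** In large dimension, the classical choice of the constants already makes
    the failure probability small: it is at most [exp (- N kappa / 2) + 4 / n]. *)
Lemma large_dimension (A : nat) (delta : R) : 0 < delta ->
  exists n0 : nat, exists N1 : R, forall N n s : nat,
    (0 < N)%N -> (1 < n)%N -> (0 < s)%N -> (n0 <= n)%N -> N1 <= N%:R ->
    sample_constant A * s%:R * ln n%:R <= N%:R ->
    tau_large * Num.sqrt (ln n%:R / N%:R) * theta <= 64 /\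
    (2 * n%:R) ^+ (A * s).+2 * expR (- (N%:R * kappa))
    + 4 * n%:R ^+ 2 * expR (- (kappa3 * tau_large ^+ 2 * ln n%:R)) <= delta.
Proof.
move=> d0; have [n0 hn0] := nat_above (8 / delta).
exists n0, (4 / (kappa * delta)) => N n s N0 n1 s0 nn0 hN hsample.
have NR : 0 < N%:R :> R by rewrite ltr0n.
have nR : 2 <= n%:R :> R by rewrite ler_nat.
have sR : 1 <= s%:R :> R by rewrite ler1n.
have n_gt0 : 0 < n%:R :> R by lra.
have l0 : 0 < ln n%:R :> R by rewrite ln_gt0// ltr1n.
have tt : tau_large ^+ 2 = 3 / kappa3 by rewrite sqr_sqrtr// divr_ge0// ltW.
have t0 : 0 <= tau_large := sqrtr_ge0 _.
set r := Num.sqrt _; have r0 : 0 <= r := sqrtr_ge0 _.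
have rr : N%:R * r ^+ 2 = ln n%:R by exact: rate_sq.
have c1 : 0 <= tau_large ^+ 2 * theta ^+ 2 by rewrite mulr_ge0 ?sqr_ge0.
have c2 : 0 <= 4 * (A%:R + 2) / kappa.
  by rewrite divr_ge0 ?(ltW k0)// mulr_ge0// addr_ge0.
have hs1 : sample_constant A * ln n%:R <= sample_constant A * s%:R * ln n%:R.
  rewrite -mulrA ler_wpM2l ?addr_ge0// ler_peMl// ltW//.
split.
  have : (tau_large * r * theta) ^+ 2 <= 1 ^+ 2.
    rewrite expr1n !exprMn mulrAC -(ler_pM2l NR) mulr1 mulrCA rr.
    rewrite (le_trans _ (le_trans hs1 hsample))// ler_wpM2r ?(ltW l0)//.
    by rewrite lerDr.
  rewrite ler_sqr ?nnegrE ?mulr_ge0 ?(ltW th0)//; lra.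
have h1 : (2 * n%:R) ^+ (A * s).+2 * expR (- (N%:R * kappa)) <= delta / 2.
  have hb : (2 * n%:R) ^+ (A * s).+2 <= expR (N%:R * kappa / 2).
    apply: (@le_trans _ _ (expR (2 * ln n%:R) ^+ (A * s).+2)).
      apply: lerXn2r; rewrite ?nnegrE ?expR_ge0 ?mulr_ge0 ?(ltW n_gt0)//.
      rewrite (_ : 2 * ln n%:R = ln n%:R + ln n%:R); last by ring.
      by rewrite expRD lnK ?posrE// ler_wpM2r// ltW.
    rewrite -expRM_natl ler_expR.
    have : (A * s).+2%:R <= (A%:R + 2) * s%:R :> R.
      by rewrite -addn2 natrD natrM; lra.
    move=> hA; apply: (@le_trans _ _ ((A%:R + 2) * s%:R * (2 * ln n%:R))).
      by rewrite ler_wpM2r// mulr_ge0// ltW.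
    rewrite ler_pdivlMr// -ler_pdivrMr//; apply: le_trans hsample.
    rewrite [leLHS](_ : _ = 4 * (A%:R + 2) / kappa * s%:R * ln n%:R); last by field; rewrite gt_eqF.
    rewrite ler_wpM2r ?(ltW l0)// ler_wpM2r ?ler0n//.
    by rewrite lerDl.
  apply: (le_trans (ler_wpM2r (expR_ge0 _) hb)); rewrite -expRD.
  have -> : N%:R * kappa / 2 + - (N%:R * kappa) = - (N%:R * kappa / 2) by field.
  have p0 : 0 < N%:R * kappa / 2 by rewrite divr_gt0// mulr_gt0.
  apply: (le_trans (expRN_le_inv p0)).
  rewrite -[leLHS]mul1r ler_pdivrMr//.
  move: hN; rewrite ler_pdivrMr ?mulr_gt0// => hN.
  by rewrite (_ : delta / 2 * (N%:R * kappa / 2) = N%:R * (kappa * delta) / 4); [lra|field].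
have h2 : 4 * n%:R ^+ 2 * expR (- (kappa3 * tau_large ^+ 2 * ln n%:R)) <= delta / 2.
  have -> : kappa3 * tau_large ^+ 2 * ln n%:R = 3%:R * ln n%:R.
    by rewrite tt mulrCA divff ?gt_eqF// mulr1.
  rewrite expRN expRM_natl lnK ?posrE//.
  rewrite (_ : 4 * n%:R ^+ 2 * (n%:R ^+ 3)^-1 = 4 / n%:R); last first.
    by field; rewrite gt_eqF.
  rewrite ler_pdivrMr//; move: hn0; rewrite ler_pdivrMr// => hn0.
  have : n0%:R <= n%:R :> R by rewrite ler_nat.
  by move=> h; have := ler_wpM2r (ltW d0) h; lra.
lra.
Qed.

(** In bounded dimension, a large [tau] and then a large sample size make the
    failure probability small. *)
Lemma small_dimension (n0 q : nat) (delta : R) : 0 < delta -> (0 < n0)%N ->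
  exists2 tau : R, 0 < tau & exists N1 : R, forall N n : nat,
    (0 < N)%N -> (1 < n)%N -> (n <= n0)%N -> N1 <= N%:R ->
    [/\ tau * Num.sqrt (ln n%:R / N%:R) * theta <= 64,
        n%:R * (tau * Num.sqrt (ln n%:R / N%:R)) <= 1 / 2 &
    (2 * n%:R) ^+ q * expR (- (N%:R * kappa))
    + 4 * n%:R ^+ 2 * expR (- (kappa3 * tau ^+ 2 * ln n%:R)) <= delta].
Proof.
move=> d0 n00; have n0R : 0 < n0%:R :> R by rewrite ltr0n.
have l2 : 0 < ln 2 :> R by rewrite ln_gt0// ltr1n.
pose tau2 : R := 8 * n0%:R ^+ 2 / (kappa3 * ln 2 * delta).
have t20 : 0 < tau2 by rewrite divr_gt0 ?mulr_gt0 ?exprn_gt0.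
pose tau := Num.sqrt tau2; have tau0 : 0 < tau by rewrite sqrtr_gt0.
have tt : tau ^+ 2 = tau2 by rewrite sqr_sqrtr// ltW.
exists tau => //.
exists (tau2 * theta ^+ 2 * n0%:R + 4 * n0%:R ^+ 2 * tau2 * n0%:R
   + 2 * (2 * n0%:R) ^+ q / (kappa * delta)) => N n N0 n1 nn0 hN.
have NR : 0 < N%:R :> R by rewrite ltr0n.
have nR : 2 <= n%:R :> R by rewrite ler_nat.
have n_gt0 : 0 < n%:R :> R by lra.
have nn0R : n%:R <= n0%:R :> R by rewrite ler_nat.
have l0 : ln 2 <= ln n%:R :> R by rewrite ler_ln ?posrE.
have ln_n0 : ln n%:R <= n0%:R :> R.
  by rewrite (le_trans _ nn0R)// ltW// ln_sublinear.
set r := Num.sqrt _; have r0 : 0 <= r := sqrtr_ge0 _.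
have rr : N%:R * r ^+ 2 = ln n%:R by exact: rate_sq.
have p1 : 0 <= tau2 * theta ^+ 2 * n0%:R.
  by apply: mulr_ge0; [apply: mulr_ge0; [exact: ltW|exact: sqr_ge0]|exact: ltW].
have p2 : 0 <= 4 * n0%:R ^+ 2 * tau2 * n0%:R.
  apply: mulr_ge0; last exact: ltW.
  by apply: mulr_ge0; [apply: mulr_ge0; [|exact: sqr_ge0]|exact: ltW].
have p3 : 0 <= 2 * (2 * n0%:R) ^+ q / (kappa * delta).
  by rewrite divr_ge0 ?mulr_ge0 ?exprn_ge0 ?mulr_ge0// ltW.
split.
- have : (tau * r * theta) ^+ 2 <= 1 ^+ 2.
    rewrite expr1n !exprMn mulrAC -(ler_pM2l NR) mulr1 mulrCA rr tt.
    apply: (@le_trans _ _ (tau2 * theta ^+ 2 * n0%:R)); last by lra.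
    by rewrite ler_wpM2l// mulr_ge0 ?sqr_ge0// ltW.
  rewrite ler_sqr ?nnegrE ?mulr_ge0 ?(ltW th0) ?(ltW tau0)//; lra.
- have : (n%:R * (tau * r)) ^+ 2 <= (1 / 2) ^+ 2.
    rewrite !exprMn tt -(ler_pM2l NR).
    rewrite (_ : N%:R * (n%:R ^+ 2 * (tau2 * r ^+ 2)) =
      n%:R ^+ 2 * tau2 * (N%:R * r ^+ 2)); last by ring.
    rewrite rr (@le_trans _ _ (n0%:R ^+ 2 * tau2 * n0%:R))//; last first.
      by rewrite expr1n exprVn; lra.
    have m0 x : 0 <= x ^+ 2 * tau2 by rewrite mulr_ge0 ?sqr_ge0 ?(ltW t20).
    apply: ler_pM; [exact: m0|exact: le_trans (ltW l2) l0| |exact: ln_n0].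
    by rewrite ler_wpM2r ?(ltW t20)// ler_sqr ?nnegrE ?(ltW n_gt0) ?(ltW n0R).
  by rewrite ler_sqr ?nnegrE ?mulr_ge0 ?(ltW n_gt0) ?(ltW tau0).
have h1 : (2 * n%:R) ^+ q * expR (- (N%:R * kappa)) <= delta / 2.
  have Nk : 0 < N%:R * kappa by rewrite mulr_gt0.
  apply: (@le_trans _ _ ((2 * n0%:R) ^+ q * (N%:R * kappa)^-1)).
    apply: ler_pM; rewrite ?expR_ge0 ?exprn_ge0 ?mulr_ge0 ?(ltW n_gt0)//.
      by rewrite lerXn2r ?nnegrE ?mulr_ge0 ?(ltW n_gt0) ?(ltW n0R)// ler_pM2l.
    exact: expRN_le_inv.
  rewrite ler_pdivrMr//.
  have : 2 * (2 * n0%:R) ^+ q / (kappa * delta) <= N%:R by lra.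
  rewrite ler_pdivrMr ?mulr_gt0// => h.
  by rewrite (_ : delta / 2 * (N%:R * kappa) = N%:R * (kappa * delta) / 2); [lra|ring].
have h2 : 4 * n%:R ^+ 2 * expR (- (kappa3 * tau ^+ 2 * ln n%:R)) <= delta / 2.
  have e0 : 0 < kappa3 * tau ^+ 2 * ln 2 by rewrite !mulr_gt0// tt.
  apply: (@le_trans _ _ (4 * n0%:R ^+ 2 * (kappa3 * tau ^+ 2 * ln 2)^-1)).
    apply: ler_pM; rewrite ?expR_ge0 ?mulr_ge0 ?sqr_ge0//.
      by rewrite ler_pM2l// ler_sqr ?nnegrE ?(ltW n_gt0) ?(ltW n0R).
    rewrite (le_trans _ (expRN_le_inv e0))// ler_expR lerN2 ler_wpM2l//.
    by rewrite mulr_ge0 ?sqr_ge0// ltW.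
  rewrite tt /tau2 le_eqVlt; apply/orP; left; apply/eqP; field.
  by rewrite !gt_eqF.
lra.
Qed.

End rates.

(** * The one-step estimator *)

Section instance.
Context {R : realType} d (T : measurableType d) (P : probability T R).
Context (k : nat) (nu sigma_eps sigma_x c : R) (N n s1 s2 : nat) (M : R).
Context (G : sgraph n) (X : {RV P >-> 'M[R]_(N, n)}) (eps : {RV P >-> 'cV[R]_N}).
Context (Sigma : 'M[R]_n) (beta : 'cV[R]_n) (bh : T -> 'cV[R]_n).
Context (Th : T -> 'M[R]_n) (a b : R).
Hypotheses (N0 : (0 < N)%N) (n1 : (1 < n)%N) (s10 : (0 < s1)%N).
Hypotheses (nu0 : 0 <= nu) (se0 : 0 < sigma_eps) (sx0 : 0 < sigma_x) (c0 : 0 < c).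
Hypotheses (a0 : 0 < a) (b0 : 0 < b).
Hypothesis hX : rowwise_subgaussian P sigma_x Sigma X.
Hypothesis heig : forall x : R, eigenvalue Sigma x -> c <= x.
Hypothesis hM : forall i, \sum_j `|invmx Sigma i j| <= M.
Hypothesis heps : is_mvnormal (distribution P eps) (sigma_eps ^+ 2)%:M.
Hypothesis hind : independent_rv P X eps.
Hypothesis hs : nu <= s2%:R / s1%:R.
Hypothesis hbeta : param_space G k s1 s2 beta.
Let r : R := Num.sqrt (ln n%:R / N%:R).
Let lam := a * (sigma_eps * r).
Hypothesis hlasso : forall w, is_gpp_lasso G k lam
  (lam * Num.sqrt (nu / (2 * (max_degree G)%:R) ^+ k.+1))
  (X w) (X w *m beta + eps w) (bh w).
Hypothesis hclime : forall w,
  (exists Th0, clime_feasible (sample_cov (X w)) (b * r) Th0) ->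
  is_clime (sample_cov (X w)) (b * r) (Th w).

Lemma error_bounds_probability (q : nat) (tau L H : R) : 0 < tau -> (1 < q)%N ->
  tau * r * mgf_order sigma_x c <= 64 ->
  diag_bound sigma_x c * L <= (q%:R - 1) * (c / 4) -> L <= H * s2%:R -> 1 <= H ->
  [/\ 2 * tau <= a, tau <= b & L = 36 * s2%:R] \/
    (n%:R <= L /\ n%:R * (tau * r) <= 1 / 2) ->
  exists2 B, measurable B &
    (P B <= ((2 * n%:R) ^+ q.+1 * expR (- (N%:R * sparse_rate sigma_x c))
     + 4 * n%:R ^+ 2 * expR (- (entry_rate sigma_x c * tau ^+ 2 * ln n%:R)))%:E)%E /\
    forall w, ~ B w ->
    (forall i, `|((Th w *m sample_cov (X w) - 1%:M) *m (bh w - beta)) i 0| <=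
      b * (8 / c * (tau + 2 * a) * H) * (sigma_eps * s2%:R * r ^+ 2)) /\
    (forall i j,
      `|(Th w *m sample_cov (X w) *m (Th w)^T - invmx Sigma) i j| <=
      (3 * b + 2 * tau) * (M * r)).
Proof.
move=> tau0 q1 tr hq LH H1 halt.
have l0 : 0 < ln n%:R :> R by rewrite ln_gt0// ltr1n.
have r0 : 0 < r by rewrite sqrtr_gt0 divr_gt0// ltr0n.
have q0 : (0 < q)%N by exact: ltnW.
have [mB PB] := good_event_probability N0 n1 sx0 se0 c0 hX heig heps hind q
  (mulr_gt0 tau0 r0) tr (rate_sq N0 n1).
exists (~` [set w | good_event X eps Sigma sigma_x sigma_eps c q (tau * r) w]) => //.
split => // w /contrapT[/= g1 g2 g3 g4].
have T0T := precision_symmetric N0 hX.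
have D0p : 0 <= diag_bound sigma_x c by rewrite ltW// diag_bound_gt0.
split=> [i|i j].
  exact: (one_step_error_on_good N0 q0 s10 D0p a0 b0 c0 se0 r0 tau0 nu0 hs hbeta
    (hlasso w) (hclime (w:=w)) hM g1 g2 g3 g4 hq q1 LH H1 halt).
exact: (clime_error_on_good b0 r0 tau0 (hclime (w:=w)) T0T hM g3 halt).
Qed.

End instance.

Section random_variables.
Context d d' (T : measurableType d) (T' : measurableType d').

Definition measurable_map (f : T -> T') (mf : measurable_fun setT f) :
    {mfun T >-> T'} := HB.pack f (isMeasurableFun.Build _ _ _ _ f mf).

End random_variables.

(** Substituting the linear model, the error of the pilot estimator only enters
    through the residual [Th S - I]. *)
Lemma one_step_decomposition (R : realType) (n N : nat) (X : 'M[R]_(N, n))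
    (e : 'cV[R]_N) (beta bh : 'cV[R]_n) (Th : 'M[R]_n) : (0 < N)%N ->
  Num.sqrt N%:R *: (one_step X (X *m beta + e) Th bh - beta) =
  ((Num.sqrt N%:R)^-1 *: (Th *m X^T)) *m e -
  Num.sqrt N%:R *: ((Th *m sample_cov X - 1%:M) *m (bh - beta)).
Proof.
move=> N0; set s := Num.sqrt _.
have s0 : 0 < s by rewrite sqrtr_gt0 ltr0n.
have sN : N%:R^-1 = s^-1 * s^-1 :> R.
  by rewrite -invfM -expr2 sqr_sqrtr ?ler0n.
rewrite /one_step; have -> : X *m beta + e - X *m bh = e - X *m (bh - beta).
  by rewrite mulmxBr; apply/matrixP => i j; rewrite !mxE; ring.
rewrite addrAC /sample_cov; set D := bh - beta.
rewrite mulmxBr mulmxBl mul1mx -scalemxAr -!scalemxAl !(scalerDr, scalerN).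
rewrite !scalerA sN mulrA divff ?gt_eqF// mul1r -!mulmxA opprD opprK.
by rewrite addrC -addrA.
Qed.

Lemma bigO_P_of_bounds (R : realType) (disp : nat -> measure_display)
    (T : forall m, measurableType (disp m)) (P : forall m, probability (T m) R)
    (p q : nat -> nat) (Z : forall m, T m -> 'M[R]_(p m, q m)) (u : nat -> R) :
  (forall m, measurable_fun setT (Z m)) -> (forall m, 0 <= u m) ->
  (forall delta : R, 0 < delta -> exists2 C : R, 0 < C &
     \forall m \near \oo, exists2 B, measurable B &
       (P m B <= delta%:E)%E /\
       forall w, ~ B w -> forall i j, `|Z m w i j| <= C * u m) ->
  bigO_P P (fun m w => mx_norm (Z m w)) u.
Proof.
move=> mZ u0 h delta d0; have [C C0 hC] := h _ d0; exists C => //.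
apply: filterS hC => m [B mB [PB ZB]]; apply: le_trans PB.
have -> : [set w | (C * u m < `|mx_norm (Z m w)|)%R] =
    [set w | C * u m < mx_norm (Z m w)].
  by apply/seteqP; split => w /=; rewrite ger0_norm ?mx_norm_ge0.
apply: le_measure; rewrite ?inE//; first exact: measurable_mx_norm_gt.
move=> w /= hw; apply: contrapT => /ZB hB; move: hw; rewrite ltNge => /negP; apply.
by apply/mx_norm_leP => //; rewrite mulr_ge0// ltW.
Qed.

Theorem theorem6 (R : realType) (k : nat) (nu sigma_eps sigma_x c c' : R)
  (hnu : 0 <= nu < 1) (hsigma_eps : 0 < sigma_eps) (hsigma_x : 0 < sigma_x)
  (hc : 0 < c <= c') :
  exists C0 a0 b0 : R, [/\ 0 < C0, 0 < a0, 0 < b0 &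
  forall (a b : R) (ha : a0 <= a) (hb : b0 <= b)
    (N n s1 s2 : nat -> nat) (M : nat -> R) (G : forall m, sgraph (n m))
    (disp : nat -> measure_display) (T : forall m, measurableType (disp m))
    (P : forall m, probability (T m) R)
    (X : forall m, {RV (P m) >-> 'M[R]_(N m, n m)})
    (eps : forall m, {RV (P m) >-> 'cV[R]_(N m)})
    (Sigma_x : forall m, 'M[R]_(n m)) (beta : forall m, 'cV[R]_(n m))
    (hatbeta : forall m, {RV (P m) >-> 'cV[R]_(n m)})
    (hatTheta : forall m, {mfun 'M[R]_(N m, n m) >-> 'M[R]_(n m)}),
  let y m (w : T m) := X m w *m beta m + eps m w in
  let lam m := a * (sigma_eps * Num.sqrt (ln (n m)%:R / (N m)%:R)) in
  let lamg m := lam m * Num.sqrt (nu / (2 * (max_degree (G m))%:R) ^+ k.+1) in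
  let mu m := b * Num.sqrt (ln (n m)%:R / (N m)%:R) in
  let S m (w : T m) := sample_cov (X m w) in
  let Th m (w : T m) := hatTheta m (X m w) in
  forall
    (hN : forall m, (0 < N m)%N) (hn : forall m, (1 < n m)%N)
    (hs1 : forall m, (0 < s1 m)%N) (hs2 : forall m, (0 < s2 m)%N)
    (hNoo : N @ \oo --> \oo)
    (hsample : \forall m \near \oo,
      C0 * (s2 m)%:R * ln (n m)%:R <= (N m)%:R)
    (hX : forall m, rowwise_subgaussian (P m) sigma_x (Sigma_x m) (X m))
    (heig : forall m (x : R), eigenvalue (Sigma_x m) x -> c <= x <= c')
    (hM : forall m i, \sum_j `|invmx (Sigma_x m) i j| <= M m)
    (heps : forall m,
      is_mvnormal (distribution (P m) (eps m)) (sigma_eps ^+ 2)%:M)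
    (hindep : forall m, independent_rv (P m) (X m) (eps m))
    (hbeta : forall m, param_space (G m) k (s1 m) (s2 m) (beta m))
    (hs : forall m, nu <= (s2 m)%:R / (s1 m)%:R)
    (hlasso : forall m w,
      is_gpp_lasso (G m) k (lam m) (lamg m) (X m w) (y m w) (hatbeta m w))
    (hclime : forall m w, (exists Th0, clime_feasible (S m w) (mu m) Th0) ->
      is_clime (S m w) (mu m) (Th m w)),
  exists Psi e : forall m, {RV (P m) >-> 'cV[R]_(n m)},
    [/\ forall m w,
          Num.sqrt (N m)%:R *:
            (one_step (X m w) (y m w) (Th m w) (hatbeta m w) - beta m)
          = Psi m w - e m w,
        forall m, cond_mvnormal (P m) (X m) (Psi m)
          (fun x => sigma_eps ^+ 2 *:
            (hatTheta m x *m sample_cov x *m (hatTheta m x)^T)),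
        bigO_P P (fun m w => mx_norm (e m w))
          (fun m => sigma_eps * (s2 m)%:R * ln (n m)%:R / Num.sqrt (N m)%:R) &
        bigO_P P
          (fun m w => mx_norm
            (Th m w *m S m w *m (Th m w)^T - invmx (Sigma_x m)))
          (fun m => M m * Num.sqrt (ln (n m)%:R / (N m)%:R))]].
Proof.
have /andP[nu0 _] := hnu; have /andP[c0 _] := hc.
set th := mgf_order sigma_x c; set kap := sparse_rate sigma_x c; set kap3 := entry_rate sigma_x c.
set D := diag_bound sigma_x c.
have th0 : 0 < th by exact: mgf_order_gt0.
have kap0 : 0 < kap by exact: sparse_rate_gt0.
have kap30 : 0 < kap3 by exact: entry_rate_gt0.
have D_gt0 : 0 < D by exact: diag_bound_gt0.
have [A hA] := nat_above (144 * D / c).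
have tl0 : 0 < tau_large kap3 by rewrite sqrtr_gt0 divr_gt0.
exists (sample_constant kap kap3 th A), (2 * tau_large kap3), (tau_large kap3).
split=> //.
- apply: ltr_pwDl; last by apply: mulr_ge0; exact: sqr_ge0.
  by apply: divr_gt0 => //; apply: mulr_gt0 => //; exact: ltr_wpDl.
- by rewrite mulr_gt0.
move=> a b ha hb N n s1 s2 M G disp T P X eps Sigma_x beta hatbeta hatTheta
  y lam lamg mu S Th hN hn hs1 hs2 hNoo hsample hX heig hM heps hindep hbeta hs
  hlasso hclime.
have a0 : 0 < a by rewrite (lt_le_trans _ ha)// mulr_gt0.
have b0 : 0 < b by exact: lt_le_trans hb.
have mXT m : measurable_fun setT (fun w => (X m w)^T) by exact: measurable_mxT.
have mS m : measurable_fun setT (S m).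
  by apply: measurable_mxZ; exact: measurable_mxM.
have mTh m : measurable_fun setT (Th m).
  exact: (measurableT_comp (measurable_funPT (hatTheta m)) (measurable_funPT (X m))).
pose noise_map m (x : 'M[R]_(N m, n m)) : 'M[R]_(n m, N m) :=
  (Num.sqrt (N m)%:R)^-1 *: (hatTheta m x *m x^T).
have mnoise m : measurable_fun setT (noise_map m).
  apply: measurable_mxZ; apply: measurable_mxM => //; apply: measurable_mxT.
  exact: measurable_id.
pose A_ m := measurable_map (mnoise m).
have mPsi m : measurable_fun setT (fun w => A_ m (X m w) *m eps m w).
  apply: measurable_mxM => //.
  exact: (measurableT_comp (measurable_funPT (A_ m)) (measurable_funPT (X m))).
pose err m (w : T m) : 'cV[R]_(n m) := Num.sqrt (N m)%:R *:
  ((Th m w *m S m w - 1%:M) *m (hatbeta m w - beta m)).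
have merr m : measurable_fun setT (err m).
  apply: measurable_mxZ; apply: measurable_mxM.
    apply: measurable_mxB; [exact: measurable_mxM|exact: measurable_cst].
  by apply: measurable_mxB => //; exact: measurable_cst.
exists (fun m => measurable_map (mPsi m)), (fun m => measurable_map (merr m)).
have NR m : 0 < (N m)%:R :> R by rewrite ltr0n.
have lnn m : 0 < ln (n m)%:R :> R by rewrite ln_gt0// ltr1n.
have M0 m : 0 <= M m.
  have i : 'I_(n m) := Ordinal (ltnW (hn m)).
  by rewrite (le_trans _ (hM m i))// sumr_ge0.
have bounds delta : 0 < delta -> exists2 C : R, 0 < C &
    \forall m \near \oo, exists2 B, measurable B &
      (P m B <= delta%:E)%E /\ forall w, ~ B w ->
      (forall i j, `|err m w i j| <= C *
         (sigma_eps * (s2 m)%:R * ln (n m)%:R / Num.sqrt (N m)%:R)) /\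
      (forall i j, `|(Th m w *m S m w *m (Th m w)^T - invmx (Sigma_x m)) i j| <=
         C * (M m * Num.sqrt (ln (n m)%:R / (N m)%:R))).
  move=> d0.
  have [n0 [N1 hlarge]] := large_dimension kap0 kap30 th0 A d0.
  pose L0 : R := (maxn n0 1)%:R.
  have [Q hQ] := nat_above (4 * D * L0 / c).
  have n00 : (0 < maxn n0 1)%N by rewrite leq_max orbT.
  have [tau tau0 [N2 hsmall]] := small_dimension kap0 kap30 th0 Q.+3 d0 n00.
  pose C1 := b * (8 / c * (tau_large kap3 + 2 * a) * 36).
  pose C2 := b * (8 / c * (tau + 2 * a) * L0).
  pose C3 := 3 * b + 2 * tau_large kap3.
  pose C4 := 3 * b + 2 * tau.
  have C10 : 0 < C1 by rewrite !mulr_gt0 ?invr_gt0 ?addr_gt0 ?mulr_gt0.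
  have L01 : 1 <= L0 by rewrite ler1n leq_max orbT.
  have C20 : 0 < C2.
    by rewrite !mulr_gt0 ?invr_gt0 ?addr_gt0 ?mulr_gt0// (lt_le_trans _ L01).
  have C30 : 0 < C3 by rewrite addr_gt0 ?mulr_gt0.
  have C40 : 0 < C4 by rewrite addr_gt0 ?mulr_gt0.
  exists (C1 + C2 + C3 + C4); first by move: C10 C20 C30 C40; clear; lra.
  (* the final constant dominates those of both regimes, and the squared rate
     [ln n / N] turns into [ln n / sqrt N] after scaling by [sqrt N] *)
  have conclude m (Ce Ct : R) w : Ce <= C1 + C2 + C3 + C4 -> Ct <= C1 + C2 + C3 + C4 ->
      (forall i, `|((Th m w *m S m w - 1%:M) *m (hatbeta m w - beta m)) i 0| <=
        Ce * (sigma_eps * (s2 m)%:R * Num.sqrt (ln (n m)%:R / (N m)%:R) ^+ 2)) /\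
      (forall i j, `|(Th m w *m S m w *m (Th m w)^T - invmx (Sigma_x m)) i j| <=
        Ct * (M m * Num.sqrt (ln (n m)%:R / (N m)%:R))) ->
      (forall i j, `|err m w i j| <= (C1 + C2 + C3 + C4) *
         (sigma_eps * (s2 m)%:R * ln (n m)%:R / Num.sqrt (N m)%:R)) /\
      (forall i j, `|(Th m w *m S m w *m (Th m w)^T - invmx (Sigma_x m)) i j| <=
         (C1 + C2 + C3 + C4) * (M m * Num.sqrt (ln (n m)%:R / (N m)%:R))).
    move=> hCe hCt [h1 h2]; split=> i j.
      have sN : 0 < Num.sqrt (N m)%:R :> R by rewrite sqrtr_gt0.
      rewrite (ord1 j) /err mxE normrM ger0_norm ?sqrtr_ge0//.
      apply: (le_trans (ler_wpM2l (ltW sN) (h1 i))).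
      rewrite (_ : Num.sqrt (N m)%:R * _ = Ce * (sigma_eps * (s2 m)%:R *
        ln (n m)%:R / Num.sqrt (N m)%:R)).
        by rewrite ler_wpM2r// !mulr_ge0 ?invr_ge0 ?(ltW hsigma_eps) ?(ltW (lnn m)) ?(ltW sN).
      rewrite sqr_sqrtr; last by rewrite divr_ge0// ltW.
      rewrite -[in X in ln _ / X](@sqr_sqrtr R (N m)%:R)//.
      by field; rewrite gt_eqF.
    by rewrite (le_trans (h2 i j))// ler_wpM2r// mulr_ge0 ?sqrtr_ge0.
  have hNbig (K : R) : \forall m \near \oo, K <= (N m)%:R.
    have [K' hK] := nat_above K.
    have hK' : \forall m \near \oo, (K' <= N m)%N := hNoo _ (nbhs_infty_ge K').
    by apply: filterS hK' => m h; rewrite (le_trans hK)// ler_nat.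
  have hN1 := hNbig N1; have hN2 := hNbig N2.
  near=> m.
  have mN1 : N1 <= (N m)%:R by near: m.
  have mN2 : N2 <= (N m)%:R by near: m.
  have msample : sample_constant kap kap3 th A * (s2 m)%:R * ln (n m)%:R <= (N m)%:R.
    by near: m.
  have heig' x : eigenvalue (Sigma_x m) x -> c <= x by move=> /heig/andP[].
  have s2R : 1 <= (s2 m)%:R :> R by rewrite ler1n.
  have base := error_bounds_probability (hN m) (hn m) (hs1 m) nu0 hsigma_eps
    hsigma_x c0 a0 b0 (hX m) heig' (hM m) (heps m) (hindep m) (hs m) (hbeta m)
    (hlasso m) (hclime m).
  (* the number of draws in the empirical method is proportional to the sparsity
     in large dimension, and constant in small dimension *)
  have [n0n|nn0] := leqP n0 (n m).
    have [tr pr] := hlarge _ _ _ (hN m) (hn m) (hs2 m) n0n mN1 msample.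
    have [|||||B mB [PB hB]] := base (A * s2 m).+1 _ (36 * (s2 m)%:R) 36 tl0 _ tr.
    - by rewrite ltnS muln_gt0 hs2 andbT -(ltr_nat R) (lt_le_trans _ hA)// divr_gt0// mulr_gt0.
    - rewrite -[(A * s2 m).+1%:R]natr1 addrK natrM -/D.
      rewrite (_ : D * (36 * (s2 m)%:R) = 144 * D / c * (c / 4) * (s2 m)%:R); last first.
        by field; rewrite gt_eqF.
      by rewrite [leRHS]mulrAC ler_wpM2r// ler_wpM2r ?divr_ge0 ?(ltW c0).
    - exact: lexx.
    - by rewrite ler1n.
    - by left.
    exists B => //; split; first by rewrite (le_trans PB)// lee_fin.
    move=> w /hB hw; apply: (conclude m C1 C3 w _ _ hw).
      by move: C10 C20 C30 C40; clear; lra.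
    by move: C10 C20 C30 C40; clear; lra.
  have nmax : (n m <= maxn n0 1)%N by rewrite leq_max (ltnW nn0).
  have [tr ntr pr] := hsmall _ _ (hN m) (hn m) nmax mN2.
  have [|||||B mB [PB hB]] := base Q.+2 tau L0 L0 tau0 _ tr.
  - by [].
  - rewrite -[Q.+2%:R]natr1 addrK -[Q.+1%:R]natr1 -/D.
    rewrite (_ : D * L0 = 4 * D * L0 / c * (c / 4)); last by field; rewrite gt_eqF.
    by rewrite ler_wpM2r ?divr_ge0 ?(ltW c0)// (le_trans hQ)// lerDl.
  - by rewrite ler_peMr// (le_trans _ L01).
  - exact: L01.
  - by right; split => //; rewrite ler_nat.
  exists B => //; split; first by rewrite (le_trans PB)// lee_fin.
  move=> w /hB hw; apply: (conclude m C2 C4 w _ _ hw).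
    by move: C10 C20 C30 C40; clear; lra.
  by move: C10 C20 C30 C40; clear; lra.
split.
- move=> m w /=; exact: one_step_decomposition.
- move=> m; apply: (linear_cond_mvnormal (hindep m) (heps m) (A := A_ m)) => x.
  congr (_ *: _); rewrite /= /noise_map; set B := hatTheta m x *m x^T.
  have -> : ((Num.sqrt (N m)%:R)^-1 *: B)^T = (Num.sqrt (N m)%:R)^-1 *: B^T.
    by rewrite linearZ.
  rewrite {}/B /sample_cov -!scalemxAr -!scalemxAl scalerA.
  by rewrite -invfM -expr2 sqr_sqrtr ?ler0n// trmx_mul trmxK !mulmxA.
- apply: (bigO_P_of_bounds merr) => [m|delta /bounds[C C0 hC]].
    by rewrite !mulr_ge0 ?invr_ge0 ?sqrtr_ge0 ?(ltW hsigma_eps) ?(ltW (lnn m)).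
  exists C => //; apply: filterS hC => m [B mB [PB hB]].
  by exists B => //; split => // w /hB[].
- have mE m : measurable_fun setT
      (fun w => Th m w *m S m w *m (Th m w)^T - invmx (Sigma_x m)).
    apply: measurable_mxB; last exact: measurable_cst.
    apply: measurable_mxM; [exact: measurable_mxM|exact: measurable_mxT].
  apply: (bigO_P_of_bounds mE) => [m|delta /bounds[C C0 hC]].
    by rewrite mulr_ge0 ?sqrtr_ge0.
  exists C => //; apply: filterS hC => m [B mB [PB hB]].
  by exists B => //; split => // w /hB[].
Unshelve. all: by end_near. Qed.
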